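(* Let $0\le\beta\le1$ and $f\in\mathcal{A}_{\beta}$ with $f(z)=z+\sum_{n=2}^\infty a_nz^n$. Let $\Gamma_1=-\tfrac12 a_2$ and $\Gamma_2=-\tfrac12\left(a_3-\tfrac32 a_2^2\right)$. Then \[ |\Gamma_1|\le\frac{1}{2-\beta}\qquad\text{and}\qquad|\Gamma_2|\le\frac{5-2\beta-\beta^2}{(2-\beta)^2(3-2\beta)}. \] Both estimates are sharp (attained by some $f\in\mathcal{A}_\beta$).
   Context: $\mathbb{D}$ is the open unit disk; $\mathcal{A}$ is the class of holomorphic $f$ on $\mathbb{D}$ with $f(0)=0$, $f'(0)=1$. For $\beta\in[0,1]$, $\mathcal{A}_{\beta}=\{f\in\mathcal{A}: \operatorname{Re}\big(\beta\, f(z)/z+(1-\beta)f'(z)\big)>0 \text{ for all } z\in\mathbb{D}\}$. The $\Gamma_n$ are the logarithmic inverse coefficients, defined by $\log(f^{-1}(w)/w)=2\sum_{n\ge1}\Gamma_nw^n$ near $0$, where $f^{-1}$ is the local inverse of $f$; the formulas above are the resulting expressions in terms of $a_2,a_3$. *)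

(* Defs.v *)
From Stdlib Require Import Reals Arith.
From Coquelicot Require Import Coquelicot.
Open Scope R_scope.

Definition C_differentiable (f : C -> C) (z : C) : Prop :=
  @ex_derive C_AbsRing C_NormedModule f z.

Definition holomorphic_on_disk (f : C -> C) : Prop :=
  forall z : C, Cmod z < 1 -> C_differentiable f z.

Fixpoint C_derive_n (n : nat) (f : C -> C) : C -> C :=
  match n with
  | O => f
  | S m => C_derive (C_derive_n m f)
  end.

Definition coef (f : C -> C) (n : nat) : C :=
  Cdiv (C_derive_n n f (RtoC 0)) (RtoC (INR (Factorial.fact n))).

Definition class_A (f : C -> C) : Prop :=
  holomorphic_on_disk f /\ f (RtoC 0) = RtoC 0 /\ C_derive f (RtoC 0) = RtoC 1.

(** Class A_beta.  At z = 0 the quotient f(z)/z is (by continuity) f'(0) = 1,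
    so the expression equals beta + (1 - beta) = 1 > 0 there automatically;
    the condition is therefore imposed for 0 < |z| < 1. *)
Definition class_A_beta (beta : R) (f : C -> C) : Prop :=
  class_A f /\
  forall z : C, Cmod z < 1 -> z <> RtoC 0 ->
    0 < Re (Cplus (Cmult (RtoC beta) (Cdiv (f z) z))
                  (Cmult (RtoC (1 - beta)) (C_derive f z))).

Definition Gamma1 (f : C -> C) : C :=
  Cmult (RtoC (- / 2)) (coef f 2).

Definition Gamma2 (f : C -> C) : C :=
  Cmult (RtoC (- / 2))
        (Cminus (coef f 3) (Cmult (RtoC (3 / 2)) (Cmult (coef f 2) (coef f 2)))).

(* Main.v *)
Require Import Defs.
From Stdlib Require Import Reals Factorial Lra Lia ClassicalEpsilon.
From Coquelicot Require Import Coquelicot.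
Open Scope R_scope.

(** A complex differentiable function on the disk is a power series: Goursat's theorem, applied to
    [zeta |-> g (exp zeta) * exp zeta] on a rectangle of height [2 PI], shows that the integral of
    [g] over the circle of radius [r] is locally constant in [r]; it tends to [0] with [r], and by
    continuity it does not jump at a radius carrying a single point where [g] is only continuous.
    Taking for [g] a difference quotient of [f] gives Cauchy's formula and the Taylor expansion.

    If [f] is in the class, [P = beta f(z)/z + (1 - beta) f'] has positive real part, and its
    coefficients are [c1 = (2 - beta) a2] and [c2 = (3 - 2 beta) a3].  The measure
    [Re P(r e^it) dt / (2 PI)] is a probability measure with moments [m1 = c1 r / 2] and
    [m2 = c2 r^2 / 2], so with [u = e^(-it)],
    [|m2 - m1^2| = |E (u - m1)^2| <= E |u - m1|^2 = 1 - |m1|^2].  As [r -> 1] this gives [|c1| <= 2]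
    and [|c2 - v c1^2| <= 4 v - 2] for [v >= 1]; the theorem is the case
    [v = 3 (3 - 2 beta) / (2 (2 - beta)^2)].  The power series [f] for which
    [P = (1 + z) / (1 - z)] attains both bounds. *)

(** * Continuity and integration of complex-valued functions *)

(** [holomorphic_on_disk] gives a derivative at each point and no continuity of it, so nothing can
    be differentiated under an integral sign: hence a bisection proof of Goursat's theorem. The
    higher derivatives behind [coef] are not given either; they come from the expansion. Only
    concentric circles have to be compared, and the exponential turns an annulus into a rectangle,
    so rectangles are the only contours. Positivity enters through the weight [Re (P z)] on circles
    of radius [r < 1]; this avoids boundary values and a representation theorem. Letting [r] tend to
    [1], [c2 - v c1^2 = 2 (m2 - m1^2) - (4 v - 2) m1^2] has modulus at most [2 + (4 v - 4) |m1|^2].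
    For [v >= 1] this is largest at [|m1| = 1], and so is [|c1| = 2 |m1|]. There the variance is
    zero, the measure is a point mass and [P] is a rotation of [(1 + z) / (1 - z)]: this is why a
    single function attains both bounds. *)

Lemma continuous_C_iff {U : UniformSpace} (f : U -> C) (x : U) :
  continuous f x <->
  forall eps : posreal, locally x (fun y => Cmod (f y - f x)%C < eps).
Proof.
  exact (filterlim_locally_ball_norm (K := C_AbsRing) (U := C_NormedModule) f (f x)).
Qed.

(** A differential is stated through every limit point of the neighbourhood filter; by uniqueness of
    limits that point is [z], which leaves the usual first-order estimate. *)
Lemma is_derive_C_iff (f : C -> C) (z l : C) :
  @is_derive C_AbsRing C_NormedModule f z l <->
  forall eps : posreal, exists d : posreal, forall y, Cmod (y - z)%C < d ->
    Cmod (f y - f z - (y - z) * l)%C <= eps * Cmod (y - z)%C.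
Proof.
  split.
  - intros [_ H] eps.
    exact (H z (fun P HP => HP) eps).
  - intros H; split.
    + apply is_linear_scal_l.
    + intros x Hx eps.
      replace x with z.
      * exact (H eps).
      * apply (is_filter_lim_locally_unique (V := AbsRing_NormedModule C_AbsRing) z x Hx).
Qed.

Lemma locally_C_Cmod (z : C) (P : C -> Prop) :
  locally (T := C_UniformSpace) z P <->
  exists d : posreal, forall y, Cmod (y - z)%C < d -> P y.
Proof.
  split; intros H.
  - exact (locally_norm_le_locally (K := C_AbsRing) (V := C_NormedModule) z P H).
  - exact (locally_le_locally_norm (K := C_AbsRing) (V := C_NormedModule) z P H).
Qed.

Lemma continuous_C_disk (f : C -> C) (z : C) :
  continuous (T := C_UniformSpace) (U := C_UniformSpace) f z <->
  forall eps : posreal, exists d : posreal, forall y, Cmod (y - z)%C < d ->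
    Cmod (f y - f z)%C < eps.
Proof.
  rewrite continuous_C_iff.
  split; intros H eps; specialize (H eps); apply locally_C_Cmod; exact H.
Qed.

Lemma Cmod_triangle_rev (x y : C) : Cmod x <= Cmod (x - y)%C + Cmod y.
Proof.
  replace x with ((x - y) + y)%C at 1 by ring.
  apply Cmod_triangle.
Qed.

Lemma Cmod_sub_sym (x y : C) : Cmod (x - y)%C = Cmod (y - x)%C.
Proof.
  rewrite <- Cmod_opp; f_equal; ring.
Qed.

Lemma continuous_C_pair {U : UniformSpace} (f : U -> C) (x : U) :
  continuous (fun y => Re (f y)) x -> continuous (fun y => Im (f y)) x ->
  continuous f x.
Proof.
  intros H1 H2.
  apply (continuous_ext (fun y => (Re (f y), Im (f y)))).
  - intros y; destruct (f y); reflexivity.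
  - apply (continuous_comp_2 (fun y => Re (f y)) (fun y => Im (f y)) (fun a b => (a, b)) x H1 H2).
    apply (continuous_ext (fun z => z)); [intros []; reflexivity | apply continuous_id].
Qed.

Lemma continuous_Re {U : UniformSpace} (f : U -> C) (x : U) :
  continuous f x -> continuous (fun y => Re (f y)) x.
Proof.
  intros H; apply (continuous_comp f fst x H).
  destruct (f x); apply continuous_fst.
Qed.

Lemma continuous_Im {U : UniformSpace} (f : U -> C) (x : U) :
  continuous f x -> continuous (fun y => Im (f y)) x.
Proof.
  intros H; apply (continuous_comp f snd x H).
  destruct (f x); apply continuous_snd.
Qed.

Lemma continuous_Cmult {U : UniformSpace} (f g : U -> C) (x : U) :
  continuous f x -> continuous g x ->
  continuous (fun y => f y * g y)%C x.
Proof.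
  intros Hf Hg.
  pose proof (continuous_Re f x Hf) as Hf1; pose proof (continuous_Im f x Hf) as Hf2.
  pose proof (continuous_Re g x Hg) as Hg1; pose proof (continuous_Im g x Hg) as Hg2.
  apply continuous_C_pair; unfold Re, Im in *; simpl.
  - apply (continuous_minus (K := R_AbsRing) (V := R_NormedModule));
      apply (continuous_mult (K := R_AbsRing)); assumption.
  - apply (continuous_plus (K := R_AbsRing) (V := R_NormedModule));
      apply (continuous_mult (K := R_AbsRing)); assumption.
Qed.

Lemma continuous_Cinv {U : UniformSpace} (f : U -> C) (x : U) :
  continuous f x -> f x <> 0 -> continuous (fun y => / f y)%C x.
Proof.
  intros Hf Hx.
  pose proof (proj1 (Cmod_gt_0 _) Hx) as Hpos.
  rewrite continuous_C_iff in Hf; apply continuous_C_iff; intros eps.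
  set (m := Cmod (f x)) in *.
  (* The first bound keeps [Cmod (f y)] above [m / 2]; with it, the second makes
     [Cmod (f x - f y) / (Cmod (f y) * m)] less than [eps]. *)
  assert (Hd : 0 < Rmin (m / 2) (eps * m * m / 2)).
  { apply Rmin_pos; [lra|].
    pose proof (cond_pos eps).
    assert (0 < eps * m) by (apply Rmult_lt_0_compat; assumption).
    assert (0 < eps * m * m) by (apply Rmult_lt_0_compat; assumption).
    lra. }
  generalize (Hf (mkposreal _ Hd)); apply filter_imp; simpl; intros y Hy.
  assert (H1 : Cmod (f y - f x)%C < m / 2) by (eapply Rlt_le_trans; [exact Hy|apply Rmin_l]).
  assert (H2 : Cmod (f y - f x)%C < eps * m * m / 2) by (eapply Rlt_le_trans; [exact Hy|apply Rmin_r]).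
  assert (H3 : m / 2 < Cmod (f y)).
  { pose proof (Cmod_triangle_rev (f x) (f y)); rewrite Cmod_sub_sym in H.
    unfold m in *; lra. }
  assert (Hy0 : f y <> 0) by (apply Cmod_gt_0; unfold m in *; lra).
  replace (/ f y - / f x)%C with ((f x - f y) / (f y * f x))%C by (field; split; assumption).
  rewrite Cmod_div by (apply Cmult_neq_0; assumption).
  rewrite Cmod_mult, Cmod_sub_sym; fold m.
  apply (Rmult_lt_reg_r (Cmod (f y) * m)).
  { apply Rmult_lt_0_compat; lra. }
  unfold Rdiv; rewrite Rmult_assoc, Rinv_l by (apply Rgt_not_eq; apply Rmult_lt_0_compat; lra).
  rewrite Rmult_1_r.
  eapply Rlt_le_trans; [exact H2|].
  pose proof (cond_pos eps).
  replace (eps * m * m / 2) with (eps * m * (m / 2)) by field.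
  replace (eps * (Cmod (f y) * m)) with (eps * m * Cmod (f y)) by ring.
  apply Rmult_le_compat_l; [|lra].
  apply Rlt_le, Rmult_lt_0_compat; assumption.
Qed.

Lemma continuous_Cpow {U : UniformSpace} (f : U -> C) (n : nat) (x : U) :
  continuous f x -> continuous (fun y => f y ^ n)%C x.
Proof.
  intros Hf; induction n as [|n IH]; simpl.
  - apply continuous_const.
  - apply continuous_Cmult; assumption.
Qed.

Definition CInt (f : R -> C) (a b : R) : C := @RInt C_R_CompleteNormedModule f a b.
Definition is_CInt (f : R -> C) (a b : R) (l : C) : Prop := @is_RInt C_R_NormedModule f a b l.

Lemma is_CInt_unique (f : R -> C) (a b : R) (l : C) : is_CInt f a b l -> CInt f a b = l.
Proof.
  exact (@is_RInt_unique C_R_CompleteNormedModule f a b l).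
Qed.

Lemma CInt_correct (f : R -> C) (a b : R) :
  a <= b -> (forall t, a <= t <= b -> continuous f t) -> is_CInt f a b (CInt f a b).
Proof.
  intros Hab H.
  apply (@RInt_correct C_R_CompleteNormedModule).
  apply (@ex_RInt_continuous C_R_CompleteNormedModule).
  rewrite Rmin_left, Rmax_right by assumption; exact H.
Qed.

Lemma is_CInt_ext (f g : R -> C) (a b : R) (l : C) :
  a <= b -> (forall t, a <= t <= b -> f t = g t) -> is_CInt f a b l -> is_CInt g a b l.
Proof.
  intros Hab H; apply is_RInt_ext.
  rewrite Rmin_left, Rmax_right by assumption.
  intros t Ht; apply H; lra.
Qed.

Lemma is_CInt_plus (f g : R -> C) (a b : R) (lf lg : C) :
  is_CInt f a b lf -> is_CInt g a b lg -> is_CInt (fun t => f t + g t)%C a b (lf + lg)%C.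
Proof.
  exact (is_RInt_plus (V := C_R_NormedModule) f g a b lf lg).
Qed.

Lemma is_CInt_minus (f g : R -> C) (a b : R) (lf lg : C) :
  is_CInt f a b lf -> is_CInt g a b lg -> is_CInt (fun t => f t - g t)%C a b (lf - lg)%C.
Proof.
  exact (is_RInt_minus (V := C_R_NormedModule) f g a b lf lg).
Qed.

Lemma is_CInt_pair (f : R -> C) (a b : R) (l : C) :
  is_RInt (fun t => Re (f t)) a b (Re l) -> is_RInt (fun t => Im (f t)) a b (Im l) ->
  is_CInt f a b l.
Proof.
  intros H1 H2; destruct l as [l1 l2].
  exact (is_RInt_fct_extend_pair (U := R_NormedModule) (V := R_NormedModule) f a b l1 l2 H1 H2).
Qed.

Lemma is_CInt_Re (f : R -> C) (a b : R) (l : C) :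
  is_CInt f a b l -> is_RInt (fun t => Re (f t)) a b (Re l).
Proof.
  exact (is_RInt_fct_extend_fst (U := R_NormedModule) (V := R_NormedModule) f a b l).
Qed.

Lemma is_CInt_Im (f : R -> C) (a b : R) (l : C) :
  is_CInt f a b l -> is_RInt (fun t => Im (f t)) a b (Im l).
Proof.
  exact (is_RInt_fct_extend_snd (U := R_NormedModule) (V := R_NormedModule) f a b l).
Qed.

Lemma is_CInt_mult (c : C) (f : R -> C) (a b : R) (l : C) :
  is_CInt f a b l -> is_CInt (fun t => c * f t)%C a b (c * l)%C.
Proof.
  intros H; pose proof (is_CInt_Re _ _ _ _ H) as H1; pose proof (is_CInt_Im _ _ _ _ H) as H2.
  apply is_CInt_pair; unfold Re, Im in *; simpl.
  - apply (is_RInt_minus (V := R_NormedModule));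
      apply (is_RInt_scal (V := R_NormedModule)); assumption.
  - apply (is_RInt_plus (V := R_NormedModule));
      apply (is_RInt_scal (V := R_NormedModule)); assumption.
Qed.

Lemma is_CInt_const (c : C) (a b : R) : is_CInt (fun _ => c) a b (RtoC (b - a) * c)%C.
Proof.
  rewrite <- scal_R_Cmult.
  exact (is_RInt_const (V := C_R_NormedModule) a b c).
Qed.

Lemma is_CInt_real (f : R -> R) (a b l : R) :
  is_RInt f a b l -> is_CInt (fun t => RtoC (f t)) a b (RtoC l).
Proof.
  intros H; apply is_CInt_pair; simpl; [exact H|].
  pose proof (is_RInt_const (V := R_NormedModule) a b 0) as H0.
  unfold scal in H0; simpl in H0; unfold mult in H0; simpl in H0.
  rewrite Rmult_0_r in H0; exact H0.
Qed.

(** The product norm is Euclidean, so the triangle inequality for integrals holds for [Cmod] with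
    constant [1]; the sharp constants of the theorem depend on this. *)
Lemma norm_C_R (z : C) : @norm R_AbsRing C_R_NormedModule z = Cmod z.
Proof.
  destruct z as [x y].
  unfold norm; simpl; unfold prod_norm, Cmod; simpl.
  f_equal; unfold norm; simpl; unfold abs; simpl.
  rewrite !Rmult_1_r, <- !Rabs_mult.
  rewrite !Rabs_right; [reflexivity | apply Rle_ge, Rle_0_sqr | apply Rle_ge, Rle_0_sqr].
Qed.

Lemma is_CInt_norm_le (f : R -> C) (g : R -> R) (a b : R) (lf : C) (lg : R) :
  a <= b -> (forall t, a <= t <= b -> Cmod (f t) <= g t) ->
  is_CInt f a b lf -> is_RInt g a b lg -> Cmod lf <= lg.
Proof.
  intros Hab H Hf Hg; rewrite <- norm_C_R.
  apply (norm_RInt_le (V := C_R_NormedModule) f g a b lf lg Hab); trivial.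
  intros t Ht; rewrite norm_C_R; apply H; exact Ht.
Qed.

Lemma is_CInt_norm_le_const (f : R -> C) (K a b : R) (l : C) :
  a <= b -> (forall t, a <= t <= b -> Cmod (f t) <= K) ->
  is_CInt f a b l -> Cmod l <= (b - a) * K.
Proof.
  intros Hab H Hf.
  apply (is_CInt_norm_le f (fun _ => K) a b l _ Hab H Hf).
  apply (is_RInt_const (V := R_NormedModule)).
Qed.

Lemma is_CInt_Chasles (f : R -> C) (a b c : R) (l1 l2 : C) :
  is_CInt f a b l1 -> is_CInt f b c l2 -> is_CInt f a c (l1 + l2)%C.
Proof.
  exact (is_RInt_Chasles (V := C_R_NormedModule) f a b c l1 l2).
Qed.

(** * Goursat's theorem on rectangles *)

(** The integral of [F dz] counterclockwise along the boundary: [dz] is [dx] on the horizontal sides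
    and [i dy] on the vertical ones. *)
Definition rect_int (F : C -> C) (a b c d : R) : C :=
  (CInt (fun x => F (x, c)) a b + Ci * CInt (fun y => F (b, y)) c d
   - CInt (fun x => F (x, d)) a b - Ci * CInt (fun y => F (a, y)) c d)%C.

Definition continuous_on_rect (F : C -> C) (a b c d : R) : Prop :=
  forall x y, a <= x <= b -> c <= y <= d ->
    continuous (T := C_UniformSpace) (U := C_UniformSpace) F (x, y).

Lemma continuous_horizontal (F : C -> C) (x y : R) :
  continuous (T := C_UniformSpace) (U := C_UniformSpace) F (x, y) ->
  continuous (fun t : R => F (t, y)) x.
Proof.
  intros H; apply (continuous_comp (V := C_UniformSpace) (fun t : R => (t, y) : C_UniformSpace) F x).
  - apply continuous_C_pair; simpl; [apply continuous_id | apply continuous_const].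
  - exact H.
Qed.

Lemma continuous_vertical (F : C -> C) (x y : R) :
  continuous (T := C_UniformSpace) (U := C_UniformSpace) F (x, y) ->
  continuous (fun t : R => F (x, t)) y.
Proof.
  intros H; apply (continuous_comp (V := C_UniformSpace) (fun t : R => (x, t) : C_UniformSpace) F y).
  - apply continuous_C_pair; simpl; [apply continuous_const | apply continuous_id].
  - exact H.
Qed.

Lemma CInt_Chasles (f : R -> C) (a m b : R) :
  a <= m <= b -> (forall t, a <= t <= b -> continuous f t) ->
  CInt f a b = (CInt f a m + CInt f m b)%C.
Proof.
  intros Hm H; apply is_CInt_unique, is_CInt_Chasles with m;
    apply CInt_correct; try lra; intros t Ht; apply H; lra.
Qed.

Lemma rect_int_split (F : C -> C) (a m b c n d : R) :
  a <= m <= b -> c <= n <= d -> continuous_on_rect F a b c d ->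
  rect_int F a b c d =
  (rect_int F a m c n + rect_int F m b c n + rect_int F a m n d + rect_int F m b n d)%C.
Proof.
  intros Hm Hn HF; unfold rect_int.
  rewrite (CInt_Chasles (fun x => F (x, c)) a m b), (CInt_Chasles (fun x => F (x, d)) a m b),
    (CInt_Chasles (fun y => F (a, y)) c n d), (CInt_Chasles (fun y => F (b, y)) c n d);
    try assumption;
    try (intros t Ht; (apply continuous_horizontal || apply continuous_vertical); apply HF; lra).
  ring.
Qed.

Lemma is_CInt_id (a b : R) : is_CInt (fun t => RtoC t) a b (RtoC ((b ^ 2 - a ^ 2) / 2)).
Proof.
  apply (is_CInt_real (fun t => t)).
  replace ((b ^ 2 - a ^ 2) / 2) with (minus (b ^ 2 / 2) (a ^ 2 / 2))
    by (unfold minus, plus, opp; simpl; field).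
  apply (is_RInt_derive (V := R_CompleteNormedModule) (fun t => t ^ 2 / 2)).
  - intros x _; auto_derive; trivial; field.
  - intros x _; apply continuous_id.
Qed.

Lemma C_pair_eq (x y : R) : ((x, y) : C) = (RtoC x + Ci * RtoC y)%C.
Proof.
  unfold RtoC, Ci, Cplus, Cmult; simpl; f_equal; ring.
Qed.

Lemma is_CInt_affine_horizontal (A B : C) (y a b : R) :
  is_CInt (fun x => A + B * (x, y))%C a b
    (RtoC (b - a) * A + B * (RtoC ((b ^ 2 - a ^ 2) / 2) + RtoC (b - a) * (Ci * RtoC y)))%C.
Proof.
  apply is_CInt_plus; [apply is_CInt_const|].
  apply is_CInt_mult.
  apply (is_RInt_ext (V := C_R_NormedModule) (fun x => (RtoC x + Ci * RtoC y)%C)).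
  - intros x _; symmetry; apply C_pair_eq.
  - apply is_CInt_plus; [apply is_CInt_id | apply is_CInt_const].
Qed.

Lemma is_CInt_affine_vertical (A B : C) (x a b : R) :
  is_CInt (fun y => A + B * (x, y))%C a b
    (RtoC (b - a) * A + B * (RtoC (b - a) * RtoC x + Ci * RtoC ((b ^ 2 - a ^ 2) / 2)))%C.
Proof.
  apply is_CInt_plus; [apply is_CInt_const|].
  apply is_CInt_mult.
  apply (is_RInt_ext (V := C_R_NormedModule) (fun y => (RtoC x + Ci * RtoC y)%C)).
  - intros y _; symmetry; apply C_pair_eq.
  - apply is_CInt_plus; [apply is_CInt_const | apply is_CInt_mult, is_CInt_id].
Qed.

Lemma Cmod_le_abs_sum (x y : R) : Cmod (x, y) <= Rabs x + Rabs y.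
Proof.
  rewrite C_pair_eq.
  eapply Rle_trans; [apply Cmod_triangle|].
  rewrite Cmod_mult, Cmod_Ci, !Cmod_R; lra.
Qed.

(** Only the remainder of the first-order expansion contributes: it is at most [eps * s] on the
    boundary, whose length is [2 * s]. The square of [s] is what offsets the loss of a factor [4] at
    each bisection. *)
Lemma rect_int_local (F : C -> C) (x0 y0 : R) (L : C) (eps delta a b c d : R) :
  0 <= eps ->
  (forall z, Cmod (z - (x0, y0))%C < delta ->
     Cmod (F z - F (x0, y0) - (z - (x0, y0)) * L)%C <= eps * Cmod (z - (x0, y0))%C) ->
  continuous_on_rect F a b c d ->
  a <= x0 <= b -> c <= y0 <= d -> (b - a) + (d - c) < delta ->
  Cmod (rect_int F a b c d) <= 2 * eps * ((b - a) + (d - c)) ^ 2.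
Proof.
  intros Heps HL HF Hx Hy Hd.
  set (s := (b - a) + (d - c)) in *.
  set (A := (F (x0, y0) - (x0, y0) * L)%C).
  assert (Hbd : forall x y, a <= x <= b -> c <= y <= d ->
    Cmod (F (x, y) - (A + L * (x, y)))%C <= eps * s).
  { intros x y Hx' Hy'.
    assert (H1 : Cmod ((x, y) - (x0, y0))%C <= s).
    { eapply Rle_trans; [apply Cmod_le_abs_sum|]; simpl.
      assert (Rabs (x + - x0) <= b - a) by (apply Rabs_le; lra).
      assert (Rabs (y + - y0) <= d - c) by (apply Rabs_le; lra).
      unfold s; lra. }
    replace (F (x, y) - (A + L * (x, y)))%C
      with (F (x, y) - F (x0, y0) - ((x, y) - (x0, y0)) * L)%C by (unfold A; ring).
    eapply Rle_trans; [apply HL; lra|].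
    apply Rmult_le_compat_l; assumption. }
  assert (Hh : forall y, c <= y <= d -> exists I,
    Cmod I <= (b - a) * (eps * s) /\
    CInt (fun x => F (x, y)) a b = (I + (RtoC (b - a) * A +
      L * (RtoC ((b ^ 2 - a ^ 2) / 2) + RtoC (b - a) * (Ci * RtoC y))))%C).
  { intros y Hy'.
    exists (CInt (fun x => F (x, y)) a b - (RtoC (b - a) * A +
      L * (RtoC ((b ^ 2 - a ^ 2) / 2) + RtoC (b - a) * (Ci * RtoC y))))%C.
    split; [|ring].
    apply (is_CInt_norm_le_const (fun x => F (x, y) - (A + L * (x, y)))%C).
    - lra.
    - intros t Ht; apply Hbd; assumption.
    - apply is_CInt_minus; [|apply is_CInt_affine_horizontal].
      apply CInt_correct; [lra|]; intros t Ht; apply continuous_horizontal, HF; assumption. }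
  assert (Hv : forall x, a <= x <= b -> exists I,
    Cmod I <= (d - c) * (eps * s) /\
    CInt (fun y => F (x, y)) c d = (I + (RtoC (d - c) * A +
      L * (RtoC (d - c) * RtoC x + Ci * RtoC ((d ^ 2 - c ^ 2) / 2))))%C).
  { intros x Hx'.
    exists (CInt (fun y => F (x, y)) c d - (RtoC (d - c) * A +
      L * (RtoC (d - c) * RtoC x + Ci * RtoC ((d ^ 2 - c ^ 2) / 2))))%C.
    split; [|ring].
    apply (is_CInt_norm_le_const (fun y => F (x, y) - (A + L * (x, y)))%C).
    - lra.
    - intros t Ht; apply Hbd; assumption.
    - apply is_CInt_minus; [|apply is_CInt_affine_vertical].
      apply CInt_correct; [lra|]; intros t Ht; apply continuous_vertical, HF; assumption. }
  destruct (Hh c) as [I1 [HI1 E1]]; [lra|]. destruct (Hh d) as [I3 [HI3 E3]]; [lra|].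
  destruct (Hv b) as [I2 [HI2 E2]]; [lra|]. destruct (Hv a) as [I4 [HI4 E4]]; [lra|].
  unfold rect_int; rewrite E1, E2, E3, E4.
  rewrite !RtoC_minus.
  (* Each side is its affine part plus an error; the affine parts cancel around the boundary. *)
  match goal with |- Cmod ?X <= _ => replace X with (I1 + Ci * I2 - I3 - Ci * I4)%C by ring end.
  assert (T : Cmod (I1 + Ci * I2 - I3 - Ci * I4)%C <= Cmod I1 + Cmod I2 + Cmod I3 + Cmod I4).
  { eapply Rle_trans; [apply Cmod_triangle|].
    eapply Rle_trans; [apply Rplus_le_compat_r, Cmod_triangle|].
    eapply Rle_trans; [apply Rplus_le_compat_r, Rplus_le_compat_r, Cmod_triangle|].
    rewrite !Cmod_opp, !Cmod_mult, Cmod_Ci; lra. }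
  replace (2 * eps * s ^ 2) with (2 * ((b - a) * (eps * s)) + 2 * ((d - c) * (eps * s)))
    by (unfold s; ring).
  lra.
Qed.

(** The left ends increase, the right ends [a n + h / 2 ^ n] decrease, and the supremum of the left
    ends lies in every interval. *)
Lemma nested_dyadic (a : nat -> R) (h : R) :
  0 <= h -> (forall n, a n <= a (S n) <= a n + h / 2 ^ S n) ->
  exists x, forall n, a n <= x <= a n + h / 2 ^ n.
Proof.
  intros Hh Ha.
  assert (Hb : forall n, a (S n) + h / 2 ^ S n <= a n + h / 2 ^ n).
  { intros n; specialize (Ha n).
    replace (h / 2 ^ n) with (h / 2 ^ S n + h / 2 ^ S n); [lra|].
    simpl; field; apply pow_nonzero; lra. }
  assert (Hp : forall n, 0 <= h / 2 ^ n).
  { intros n; apply Rdiv_le_0_compat; [assumption | apply pow_lt; lra]. }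
  assert (Hinc : forall n k, a n <= a (n + k)%nat).
  { intros n k; induction k as [|k IH].
    - rewrite Nat.add_0_r; lra.
    - rewrite Nat.add_succ_r; specialize (Ha (n + k)%nat); lra. }
  assert (Hdec : forall n k, a (n + k)%nat + h / 2 ^ (n + k) <= a n + h / 2 ^ n).
  { intros n k; induction k as [|k IH].
    - rewrite Nat.add_0_r; lra.
    - rewrite Nat.add_succ_r; specialize (Hb (n + k)%nat); lra. }
  assert (Hub : forall n m, a m <= a n + h / 2 ^ n).
  { intros n m; destruct (Nat.le_ge_cases n m) as [H | H].
    - replace m with (n + (m - n))%nat by lia.
      specialize (Hdec n (m - n)%nat); specialize (Hp (n + (m - n))%nat); lra.
    - specialize (Hinc m (n - m)%nat); replace (m + (n - m))%nat with n in Hinc by lia.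
      specialize (Hp n); lra. }
  destruct (completeness (fun x => exists n, x = a n)) as [x [Hx1 Hx2]].
  - exists (a O + h / 2 ^ 0); intros y [n ->]; apply Hub.
  - exists (a O), O; reflexivity.
  - exists x; intros n; split.
    + apply Hx1; exists n; reflexivity.
    + apply Hx2; intros y [m ->]; apply Hub.
Qed.

Lemma Cmod_four_pigeonhole (z1 z2 z3 z4 : C) (K : R) :
  4 * K < Cmod (z1 + z2 + z3 + z4)%C ->
  K < Cmod z1 \/ K < Cmod z2 \/ K < Cmod z3 \/ K < Cmod z4.
Proof.
  intros H.
  pose proof (Cmod_triangle (z1 + z2 + z3) z4)%C.
  pose proof (Cmod_triangle (z1 + z2) z3)%C.
  pose proof (Cmod_triangle z1 z2)%C.
  destruct (Rlt_dec K (Cmod z1)); [auto|].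
  destruct (Rlt_dec K (Cmod z2)); [auto|].
  destruct (Rlt_dec K (Cmod z3)); [auto|].
  right; right; right; lra.
Qed.

(** If the integral had modulus [K > 0], bisection would give nested rectangles whose integrals
    exceed [K / 4 ^ n / 2], while differentiability at their common point makes them an arbitrarily
    small multiple of [1 / 4 ^ n]. *)
Lemma goursat (F : C -> C) (a b c d : R) :
  a <= b -> c <= d ->
  (forall x y, a <= x <= b -> c <= y <= d -> C_differentiable F (x, y)) ->
  rect_int F a b c d = 0.
Proof.
  intros Hab Hcd HF.
  set (h := b - a); set (k := d - c).
  assert (Hh : 0 <= h) by (unfold h; lra); assert (Hk : 0 <= k) by (unfold k; lra).
  assert (HC : continuous_on_rect F a b c d).
  { intros x y Hx Hy; apply continuous_C_disk; intros eps.
    destruct (HF x y Hx Hy) as [L HL].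
    pose proof (ex_derive_continuous (K := C_AbsRing) (V := C_NormedModule) F (x, y)
      (HF x y Hx Hy)) as H.
    exact (proj1 (filterlim_locally_ball_norm (K := C_AbsRing) (U := C_NormedModule) F (F (x, y))) H eps). }
  apply Cmod_eq_0; apply Rle_antisym; [|apply Cmod_ge_0].
  apply Rnot_lt_le; intros Hpos.
  set (K := Cmod (rect_int F a b c d)) in *.
  (* The factor 1/2 makes the invariant strict, also for the initial rectangle. *)
  pose (quad := fun (n : nat) (p : R * R) =>
    rect_int F (fst p) (fst p + h / 2 ^ n) (snd p) (snd p + k / 2 ^ n)).
  pose (bad := fun (n : nat) (p : R * R) =>
    a <= fst p /\ fst p + h / 2 ^ n <= b /\ c <= snd p /\ snd p + k / 2 ^ n <= d /\
    K / 4 ^ n / 2 < Cmod (quad n p)).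
  (* The implication stands under the existential so that choice yields a total function [step],
     defined also at pairs that are not [bad]. *)
  assert (Hstep : forall n p, exists p', bad n p -> bad (S n) p' /\
    fst p <= fst p' <= fst p + h / 2 ^ S n /\ snd p <= snd p' <= snd p + k / 2 ^ S n).
  { intros n p.
    destruct (excluded_middle_informative (bad n p)) as [Hbad | Hn];
      [| exists p; intros H; contradiction].
    assert (Hp2 : 0 < 2 ^ S n) by (apply pow_lt; lra).
    assert (Eh : h / 2 ^ n = h / 2 ^ S n + h / 2 ^ S n) by (simpl; field; apply pow_nonzero; lra).
    assert (Ek : k / 2 ^ n = k / 2 ^ S n + k / 2 ^ S n) by (simpl; field; apply pow_nonzero; lra).
    assert (0 <= h / 2 ^ S n) by (apply Rdiv_le_0_compat; assumption).
    assert (0 <= k / 2 ^ S n) by (apply Rdiv_le_0_compat; assumption).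
    destruct Hbad as [B1 [B2 [B3 [B4 B5]]]].
    set (x := fst p) in *; set (y := snd p) in *.
    set (h' := h / 2 ^ S n) in *; set (k' := k / 2 ^ S n) in *.
    unfold quad in B5; fold x y in B5; rewrite Eh, Ek in *.
    rewrite (rect_int_split F x (x + h') (x + (h' + h')) y (y + k') (y + (k' + k'))) in B5;
      [| lra | lra | intros u v Hu Hv; apply HC; lra ].
    replace (K / 4 ^ n / 2) with (4 * (K / 4 ^ S n / 2)) in B5
      by (simpl; field; apply pow_nonzero; lra).
    rewrite <- !Rplus_assoc in B5.
    apply Cmod_four_pigeonhole in B5.
    destruct B5 as [B5 | [B5 | [B5 | B5]]];
      [ exists (x, y) | exists (x + h', y) | exists (x, y + k') | exists (x + h', y + k') ];
      intros _; unfold bad, quad; simpl fst; simpl snd; fold h' k'; repeat split; try lra;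
      exact B5. }
  pose (step := fun n p => proj1_sig (constructive_indefinite_description _ (Hstep n p))).
  assert (Hst : forall n p, bad n p -> bad (S n) (step n p) /\
    fst p <= fst (step n p) <= fst p + h / 2 ^ S n /\
    snd p <= snd (step n p) <= snd p + k / 2 ^ S n).
  { intros n p; unfold step; apply proj2_sig. }
  pose (u := fix u n := match n with O => (a, c) | S m => step m (u m) end).
  assert (Hu : forall n, bad n (u n)).
  { intros n; induction n as [|n IH].
    - unfold bad, quad; simpl; rewrite !Rdiv_1_r.
      replace (a + h) with b by (unfold h; ring); replace (c + k) with d by (unfold k; ring).
      fold K; repeat split; lra.
    - simpl; apply Hst, IH. }
  destruct (nested_dyadic (fun n => fst (u n)) h Hh) as [x0 Hx0].
  { intros n; apply (Hst n (u n) (Hu n)). }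
  destruct (nested_dyadic (fun n => snd (u n)) k Hk) as [y0 Hy0].
  { intros n; apply (Hst n (u n) (Hu n)). }
  assert (Hx0' : a <= x0 <= b).
  { specialize (Hx0 O); simpl in Hx0; unfold h in Hx0; lra. }
  assert (Hy0' : c <= y0 <= d).
  { specialize (Hy0 O); simpl in Hy0; unfold k in Hy0; lra. }
  destruct (HF x0 y0 Hx0' Hy0') as [L HL].
  assert (Hs : 0 < 1 + (h + k) ^ 2) by (pose proof (pow2_ge_0 (h + k)); lra).
  (* With this precision the local estimate is at most [K / 4 ^ n / 4], below the invariant; the
     summand [1] covers a rectangle reduced to a point. *)
  assert (He : 0 < K / (8 * (1 + (h + k) ^ 2))) by (apply Rdiv_lt_0_compat; lra).
  destruct (proj1 (is_derive_C_iff F (x0, y0) L) HL (mkposreal _ He)) as [delta Hdelta].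
  simpl in Hdelta.
  assert (Hn : exists n, (h + k) / 2 ^ n < delta).
  { assert (Hlim : is_lim_seq (fun n => (h + k) * (/ 2) ^ n) ((h + k) * 0)).
    { apply (is_lim_seq_scal_l _ (h + k) 0), is_lim_seq_geom; rewrite Rabs_right; lra. }
    rewrite Rmult_0_r in Hlim.
    apply is_lim_seq_spec in Hlim; destruct (Hlim delta) as [N HN].
    exists N; specialize (HN N (le_n N)).
    rewrite Rminus_0_r, pow_inv in HN.
    eapply Rle_lt_trans; [apply Rle_abs | exact HN]. }
  destruct Hn as [n Hn].
  destruct (Hu n) as [B1 [B2 [B3 [B4 B5]]]].
  assert (B6 : Cmod (quad n (u n)) <= 2 * (K / (8 * (1 + (h + k) ^ 2))) * ((h + k) / 2 ^ n) ^ 2).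
  { unfold quad.
    replace ((h + k) / 2 ^ n) with ((fst (u n) + h / 2 ^ n - fst (u n)) + (snd (u n) + k / 2 ^ n - snd (u n)))
      by (field; apply pow_nonzero; lra).
    apply (rect_int_local F x0 y0 L _ delta).
    - lra.
    - exact Hdelta.
    - intros x y Hx Hy; apply HC; lra.
    - apply Hx0.
    - apply Hy0.
    - replace (fst (u n) + h / 2 ^ n - fst (u n) + (snd (u n) + k / 2 ^ n - snd (u n)))
        with ((h + k) / 2 ^ n) by (field; apply pow_nonzero; lra).
      exact Hn. }
  assert (H4 : 0 < 4 ^ n) by (apply pow_lt; lra).
  assert (E4 : ((h + k) / 2 ^ n) ^ 2 = (h + k) ^ 2 / 4 ^ n).
  { replace 4 with (2 * 2) by ring; rewrite Rpow_mult_distr; field; apply pow_nonzero; lra. }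
  rewrite E4 in B6.
  assert (B7 : 2 * (K / (8 * (1 + (h + k) ^ 2))) * ((h + k) ^ 2 / 4 ^ n) <= K / 4 ^ n / 2).
  { replace (2 * (K / (8 * (1 + (h + k) ^ 2))) * ((h + k) ^ 2 / 4 ^ n))
      with (K / 4 ^ n / 4 * ((h + k) ^ 2 / (1 + (h + k) ^ 2))) by (field; lra).
    assert (Hq : (h + k) ^ 2 / (1 + (h + k) ^ 2) <= 1).
    { apply Rle_div_l; lra. }
    assert (0 < K / 4 ^ n) by (apply Rdiv_lt_0_compat; lra).
    apply Rle_trans with (K / 4 ^ n / 4 * 1); [apply Rmult_le_compat_l; lra | lra]. }
  lra.
Qed.

(** * The complex exponential *)

Definition cis (t : R) : C := (cos t, sin t).
Definition circ (r t : R) : C := (RtoC r * cis t)%C.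
Definition Cexp (z : C) : C := circ (exp (Re z)) (Im z).

Lemma cis_plus (s t : R) : cis (s + t) = (cis s * cis t)%C.
Proof.
  unfold cis, Cmult; simpl; rewrite cos_plus, sin_plus; f_equal; ring.
Qed.

Lemma Cmod_cis (t : R) : Cmod (cis t) = 1.
Proof.
  unfold cis, Cmod; simpl fst; simpl snd.
  rewrite <- sqrt_1; f_equal.
  pose proof (sin2_cos2 t); unfold Rsqr in *; lra.
Qed.

Lemma cis_0 : cis 0 = 1.
Proof. unfold cis; rewrite cos_0, sin_0; reflexivity. Qed.

Lemma cis_2PI : cis (2 * PI) = 1.
Proof. unfold cis; rewrite cos_2PI, sin_2PI; reflexivity. Qed.

Lemma Cmod_circ (r t : R) : 0 <= r -> Cmod (circ r t) = r.
Proof.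
  intros Hr; unfold circ; rewrite Cmod_mult, Cmod_cis, Cmod_R, Rabs_right; lra.
Qed.

Lemma continuous_cis (t : R) : continuous cis t.
Proof.
  apply continuous_C_pair; unfold cis; simpl.
  - apply (ex_derive_continuous (K := R_AbsRing) (V := R_NormedModule)); auto_derive; trivial.
  - apply (ex_derive_continuous (K := R_AbsRing) (V := R_NormedModule)); auto_derive; trivial.
Qed.

Lemma continuous_RtoC {U : UniformSpace} (f : U -> R) (x : U) :
  continuous f x -> continuous (fun y => RtoC (f y)) x.
Proof.
  intros H; apply continuous_C_pair; simpl; [exact H | apply continuous_const].
Qed.

Lemma continuous_circ (r t : R) : continuous (circ r) t.
Proof.
  apply continuous_Cmult; [apply continuous_const | apply continuous_cis].
Qed.

Lemma Cexp_plus (z w : C) : Cexp (z + w) = (Cexp z * Cexp w)%C.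
Proof.
  destruct z as [a b], w as [c d]; unfold Cexp, circ; simpl.
  rewrite exp_plus, cis_plus, RtoC_mult; ring.
Qed.

Lemma is_derive_R_approx (f : R -> R) (x l : R) (eps : posreal) :
  is_derive f x l ->
  exists d : posreal, forall y, Rabs (y - x) < d ->
    Rabs (f y - f x - (y - x) * l) <= eps * Rabs (y - x).
Proof.
  intros [_ H]; exact (H x (fun P HP => HP) eps).
Qed.

Lemma im_le_Cmod (z : C) : Rabs (Im z) <= Cmod z.
Proof.
  eapply Rle_trans; [apply Rmax_r | apply Rmax_Cmod].
Qed.

(** Additivity reduces the claim to the expansion at [0], whose error combines the first-order
    errors of [exp], [cos] and [sin] with the small product [q * (exp p - 1)]. *)
Lemma is_derive_Cexp (z : C) : @is_derive C_AbsRing C_NormedModule Cexp z (Cexp z).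
Proof.
  apply is_derive_C_iff; intros eps.
  set (M := Cmod (Cexp z)).
  assert (HM : 0 <= M) by apply Cmod_ge_0.
  pose proof (cond_pos eps) as Heps.
  (* The error at [0] will be at most [6 * (e * m)] and is multiplied by [M]; [M + 1] keeps the
     denominator positive. The bound [e <= 1] serves to get [exp p <= 2]. *)
  assert (He : 0 < Rmin 1 (eps / (8 * (M + 1)))).
  { apply Rmin_pos; [lra | apply Rdiv_lt_0_compat; lra]. }
  set (e := Rmin 1 (eps / (8 * (M + 1)))) in *.
  assert (He1 : e <= 1) by apply Rmin_l.
  assert (He2 : e <= eps / (8 * (M + 1))) by apply Rmin_r.
  destruct (is_derive_R_approx exp 0 1 (mkposreal _ He)) as [d1 H1].
  { auto_derive; trivial; rewrite exp_0; ring. }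
  destruct (is_derive_R_approx cos 0 0 (mkposreal _ He)) as [d2 H2].
  { auto_derive; trivial; rewrite sin_0; ring. }
  destruct (is_derive_R_approx sin 0 1 (mkposreal _ He)) as [d3 H3].
  { auto_derive; trivial; rewrite cos_0; ring. }
  simpl in H1, H2, H3.
  rewrite exp_0 in H1; rewrite cos_0 in H2; rewrite sin_0 in H3.
  assert (Hd : 0 < Rmin (Rmin d1 d2) (Rmin d3 (e / 2))).
  { repeat apply Rmin_pos; try apply cond_pos; lra. }
  exists (mkposreal _ Hd); simpl; intros y Hy.
  set (u := (y - z)%C) in *.
  replace y with (z + u)%C by (unfold u; ring).
  rewrite Cexp_plus.
  replace (Cexp z * Cexp u - Cexp z - u * Cexp z)%C
    with (Cexp z * (Cexp u - 1 - u))%C by ring.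
  rewrite Cmod_mult; fold M.
  pose proof (re_le_Cmod u) as Hx; pose proof (im_le_Cmod u) as Hv.
  set (m := Cmod u) in *.
  assert (Hm : 0 <= m) by apply Cmod_ge_0.
  assert (Hm1 : m < d1).
  { eapply Rlt_le_trans; [exact Hy|]; eapply Rle_trans; [apply Rmin_l | apply Rmin_l]. }
  assert (Hm2 : m < d2).
  { eapply Rlt_le_trans; [exact Hy|]; eapply Rle_trans; [apply Rmin_l | apply Rmin_r]. }
  assert (Hm3 : m < d3).
  { eapply Rlt_le_trans; [exact Hy|]; eapply Rle_trans; [apply Rmin_r | apply Rmin_l]. }
  assert (Hm4 : m < e / 2).
  { eapply Rlt_le_trans; [exact Hy|]; eapply Rle_trans; [apply Rmin_r | apply Rmin_r]. }
  destruct u as [p q]; simpl in Hx, Hv; unfold Cexp, circ; simpl Re; simpl Im.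
  specialize (H1 p); specialize (H2 q); specialize (H3 q).
  rewrite Rminus_0_r in *.
  specialize (H1 ltac:(lra)); specialize (H2 ltac:(lra)); specialize (H3 ltac:(lra)).
  rewrite Rmult_1_r in *; rewrite Rmult_0_r, Rminus_0_r in *.
  assert (em : e * m <= m) by (rewrite <- (Rmult_1_l m) at 2; apply Rmult_le_compat_r; lra).
  assert (H1' : Rabs (exp p - 1 - p) <= e * m).
  { eapply Rle_trans; [exact H1|]; apply Rmult_le_compat_l; lra. }
  assert (H2' : Rabs (cos q - 1) <= e * m).
  { eapply Rle_trans; [exact H2|]; apply Rmult_le_compat_l; lra. }
  assert (H3' : Rabs (sin q - q) <= e * m).
  { eapply Rle_trans; [exact H3|]; apply Rmult_le_compat_l; lra. }
  assert (H4 : Rabs (exp p - 1) <= e).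
  { replace (exp p - 1) with ((exp p - 1 - p) + p) by ring.
    eapply Rle_trans; [apply Rabs_triang|]; lra. }
  assert (H5 : 0 < exp p <= 2).
  { split; [apply exp_pos|]; pose proof (Rle_abs (exp p - 1)); lra. }
  replace (RtoC (exp p) * cis q - 1 - (p, q))%C
    with (((exp p - 1 - p) + exp p * (cos q - 1), exp p * (sin q - q) + q * (exp p - 1)) : C)
    by (unfold cis, RtoC, Cmult, Cminus, Cplus, Copp; simpl; f_equal; ring).
  assert (H6 : Cmod ((exp p - 1 - p) + exp p * (cos q - 1), exp p * (sin q - q) + q * (exp p - 1))
    <= 6 * (e * m)).
  { eapply Rle_trans; [apply Cmod_le_abs_sum|].
    assert (A1 : Rabs (exp p - 1 - p + exp p * (cos q - 1)) <= e * m + 2 * (e * m)).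
    { eapply Rle_trans; [apply Rabs_triang|]; rewrite Rabs_mult, (Rabs_right (exp p)) by lra.
      apply Rplus_le_compat; [assumption|].
      apply Rmult_le_compat; try lra; apply Rabs_pos. }
    assert (A2 : Rabs (exp p * (sin q - q) + q * (exp p - 1)) <= 2 * (e * m) + m * e).
    { eapply Rle_trans; [apply Rabs_triang|]; rewrite !Rabs_mult, (Rabs_right (exp p)) by lra.
      apply Rplus_le_compat; apply Rmult_le_compat; try lra; apply Rabs_pos. }
    lra. }
  apply Rle_trans with (M * (6 * (e * m))); [apply Rmult_le_compat_l; assumption|].
  replace (M * (6 * (e * m))) with ((M * (6 * e)) * m) by ring.
  apply Rmult_le_compat_r; [assumption|].
  apply Rle_trans with ((M + 1) * (8 * e)); [apply Rmult_le_compat; lra|].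
  apply Rle_trans with ((M + 1) * (8 * (eps / (8 * (M + 1))))).
  - apply Rmult_le_compat_l; lra.
  - right; field; lra.
Qed.

(* [C] is a normed module over itself in two ways whose uniform structures, and
   hence records, are not convertible. *)
Lemma is_derive_C_AbsRing (f : C -> C) (z l : C) :
  @is_derive C_AbsRing C_NormedModule f z l <->
  @is_derive C_AbsRing (AbsRing_NormedModule C_AbsRing) f z l.
Proof.
  split; intros [_ H]; (split; [apply is_linear_scal_l | exact H]).
Qed.

Lemma is_derive_Cmult (f g : C -> C) (z lf lg : C) :
  @is_derive C_AbsRing C_NormedModule f z lf -> @is_derive C_AbsRing C_NormedModule g z lg ->
  @is_derive C_AbsRing C_NormedModule (fun x => f x * g x)%C z (lf * g z + f z * lg)%C.
Proof.
  intros Hf Hg.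
  apply is_derive_C_AbsRing in Hf; apply is_derive_C_AbsRing in Hg.
  apply is_derive_C_AbsRing.
  exact (is_derive_mult (K := C_AbsRing) f g z lf lg Hf Hg Cmult_comm).
Qed.

Lemma is_derive_Ccomp (f g : C -> C) (z lf lg : C) :
  @is_derive C_AbsRing C_NormedModule f (g z) lf -> @is_derive C_AbsRing C_NormedModule g z lg ->
  @is_derive C_AbsRing C_NormedModule (fun x => f (g x)) z (lg * lf)%C.
Proof.
  intros Hf Hg.
  apply is_derive_C_AbsRing in Hg.
  exact (is_derive_comp (K := C_AbsRing) (V := C_NormedModule) f g z lf lg Hf Hg).
Qed.

Lemma C_differentiable_continuous (f : C -> C) (z : C) :
  C_differentiable f z -> continuous (T := C_UniformSpace) (U := C_UniformSpace) f z.
Proof.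
  intros H; apply continuous_C_disk.
  exact (proj1 (filterlim_locally_ball_norm (K := C_AbsRing) (U := C_NormedModule) f (f z))
    (ex_derive_continuous (K := C_AbsRing) (V := C_NormedModule) f z H)).
Qed.

(** * Cauchy's theorem on circles *)

Lemma CInt_ext (f g : R -> C) (a b : R) :
  a <= b -> (forall t, a <= t <= b -> f t = g t) -> CInt f a b = CInt g a b.
Proof.
  intros Hab H; apply (@RInt_ext C_R_CompleteNormedModule).
  rewrite Rmin_left, Rmax_right by assumption.
  intros t Ht; apply H; lra.
Qed.

Definition continuous_on_disk (g : C -> C) : Prop :=
  forall z, Cmod z < 1 -> continuous (T := C_UniformSpace) (U := C_UniformSpace) g z.

(** This is the contour integral of [g dz] divided by [i], since [dz = i z dt] on the circle. *)
Definition circle_int (g : C -> C) (r : R) : C :=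
  CInt (fun t => g (circ r t) * circ r t)%C 0 (2 * PI).

Lemma continuous_on_circle (g : C -> C) (r t : R) :
  continuous_on_disk g -> 0 <= r < 1 -> continuous (fun t => g (circ r t)) t.
Proof.
  intros Hg Hr; apply (continuous_comp (V := C_UniformSpace) (circ r) g t).
  - apply continuous_circ.
  - apply Hg; rewrite Cmod_circ; lra.
Qed.

Lemma is_CInt_circle_int (g : C -> C) (r : R) :
  continuous_on_disk g -> 0 <= r < 1 ->
  is_CInt (fun t => g (circ r t) * circ r t)%C 0 (2 * PI) (circle_int g r).
Proof.
  intros Hg Hr; pose proof PI_RGT_0; apply CInt_correct; [lra|].
  intros t _; apply continuous_Cmult; [apply continuous_on_circle; assumption | apply continuous_circ].
Qed.

Lemma exp_le (x y : R) : x <= y -> exp x <= exp y.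
Proof.
  intros [H | ->]; [left; apply exp_increasing; assumption | right; reflexivity].
Qed.

(** On the rectangle between [ln r1] and [ln r2] the horizontal sides cancel because [Cexp] has
    period [2 PI i]; the vertical sides are the two circle integrals, up to the factor [i]. *)
Lemma circle_int_eq (g : C -> C) (r1 r2 : R) :
  0 < r1 -> r1 <= r2 -> r2 < 1 ->
  (forall z, r1 <= Cmod z <= r2 -> C_differentiable g z) ->
  circle_int g r1 = circle_int g r2.
Proof.
  intros H1 H12 H2 Hg; pose proof PI_RGT_0 as Hpi.
  set (G := fun z => (g (Cexp z) * Cexp z)%C).
  assert (Hln : ln r1 <= ln r2).
  { destruct H12 as [H12 | ->]; [left; apply ln_increasing; assumption | right; reflexivity]. }
  assert (H : rect_int G (ln r1) (ln r2) 0 (2 * PI) = 0).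
  { apply goursat; [exact Hln | lra |].
    intros x y Hx Hy.
    assert (HL : C_differentiable g (Cexp (x, y))).
    { apply Hg; unfold Cexp; simpl; rewrite Cmod_circ by (apply Rlt_le, exp_pos).
      rewrite <- (exp_ln r1), <- (exp_ln r2) by lra.
      split; apply exp_le; apply Hx. }
    destruct HL as [L HL].
    eexists; unfold G; apply is_derive_Cmult; [|apply is_derive_Cexp].
    apply (is_derive_Ccomp g Cexp _ L _ HL (is_derive_Cexp _)). }
  assert (Hper : CInt (fun x => G (x, 0)) (ln r1) (ln r2) = CInt (fun x => G (x, 2 * PI)) (ln r1) (ln r2)).
  { apply CInt_ext; [exact Hln|]; intros x _; unfold G, Cexp, circ; simpl Im; simpl Re.
    rewrite cis_0, cis_2PI; reflexivity. }
  assert (Hv : forall r, 0 < r -> CInt (fun y => G (ln r, y)) 0 (2 * PI) = circle_int g r).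
  { intros r Hr; apply CInt_ext; [lra|]; intros t _; unfold G, Cexp; simpl Im; simpl Re.
    rewrite exp_ln by assumption; reflexivity. }
  unfold rect_int in H; rewrite Hper, !Hv in H by lra.
  assert (E : (Ci * (circle_int g r2 - circle_int g r1))%C = 0).
  { rewrite <- H; ring. }
  apply (f_equal (fun z => - Ci * z)%C) in E.
  replace (- Ci * (Ci * (circle_int g r2 - circle_int g r1)))%C
    with (circle_int g r2 - circle_int g r1)%C in E.
  - symmetry; apply Ceq_minus; rewrite E; ring.
  - replace (- Ci * (Ci * (circle_int g r2 - circle_int g r1)))%C
      with (- (Ci * Ci) * (circle_int g r2 - circle_int g r1))%C by ring.
    replace (Ci * Ci)%C with (- RtoC 1)%C; [ring|].
    unfold Ci, Cmult, Copp, RtoC; simpl; f_equal; ring.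
Qed.

(** The factor [circ r t] has modulus [r], and [g] is bounded by [K] near [0]. *)
Lemma circle_int_small (g : C -> C) (eps : posreal) :
  continuous_on_disk g ->
  exists d : posreal, forall r, 0 < r < d -> Cmod (circle_int g r) <= eps.
Proof.
  intros Hg; pose proof PI_RGT_0 as Hpi.
  assert (H0 : Cmod 0 < 1) by (rewrite Cmod_0; lra).
  destruct (proj1 (continuous_C_disk g 0) (Hg 0 H0) (mkposreal 1 Rlt_0_1)) as [d1 Hd1].
  simpl in Hd1.
  set (K := Cmod (g 0) + 1).
  assert (HK : 0 < K) by (pose proof (Cmod_ge_0 (g 0)); unfold K; lra).
  assert (HpK : 0 < 2 * PI * K) by (apply Rmult_lt_0_compat; lra).
  assert (Hd : 0 < Rmin (Rmin d1 1) (eps / (2 * PI * K))).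
  { repeat apply Rmin_pos; try apply cond_pos; try lra.
    apply Rdiv_lt_0_compat; [apply cond_pos | assumption]. }
  exists (mkposreal _ Hd); simpl; intros r [Hr0 Hr].
  assert (Hr1 : r < d1) by (eapply Rlt_le_trans; [exact Hr|]; eapply Rle_trans; apply Rmin_l).
  assert (Hr2 : r < 1) by (eapply Rlt_le_trans; [exact Hr|]; eapply Rle_trans; [apply Rmin_l | apply Rmin_r]).
  assert (Hr3 : r < eps / (2 * PI * K)) by (eapply Rlt_le_trans; [exact Hr|]; apply Rmin_r).
  apply Rle_trans with ((2 * PI - 0) * (K * r)).
  - apply (is_CInt_norm_le_const (fun t => g (circ r t) * circ r t)%C).
    + lra.
    + intros t _; rewrite Cmod_mult, Cmod_circ by lra.
      apply Rmult_le_compat_r; [lra|].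
      pose proof (Cmod_triangle_rev (g (circ r t)) (g 0)).
      assert (Cmod (g (circ r t) - g 0)%C < 1); [|unfold K; lra].
      apply Hd1; replace (circ r t - 0)%C with (circ r t) by ring; rewrite Cmod_circ; lra.
    + apply is_CInt_circle_int; [assumption | lra].
  - apply Rlt_le; apply (Rmult_lt_compat_l (2 * PI * K)) in Hr3; [|assumption].
    replace (2 * PI * K * (eps / (2 * PI * K))) with (eps : R) in Hr3 by (field; lra).
    lra.
Qed.

Lemma circle_int_continuous (g : C -> C) (r0 : R) (eps : posreal) :
  continuous_on_disk g -> 0 < r0 < 1 ->
  exists d : posreal, forall r, Rabs (r - r0) < d ->
    Cmod (circle_int g r - circle_int g r0)%C <= eps.
Proof.
  intros Hg Hr0; pose proof PI_RGT_0 as Hpi.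
  set (G := fun p : R * R => (g (circ (fst p) (snd p)) * circ (fst p) (snd p))%C).
  assert (Hcirc : forall t, continuous (T := prod_UniformSpace R_UniformSpace R_UniformSpace) (fun p => circ (fst p) (snd p)) (r0, t)).
  { intros t; apply continuous_Cmult.
    - apply continuous_RtoC; apply continuous_fst.
    - apply (continuous_comp snd cis); [apply continuous_snd | apply continuous_cis]. }
  assert (HG : forall t, continuous (T := prod_UniformSpace R_UniformSpace R_UniformSpace) G (r0, t)).
  { intros t; apply continuous_Cmult; [|apply Hcirc].
    apply (continuous_comp (V := C_UniformSpace) (fun p => circ (fst p) (snd p)) g); [apply Hcirc|].
    simpl; apply Hg; rewrite Cmod_circ; lra. }
  (* Uniform continuity along the compact segment [r = r0] is applied to each component; two errors
     [eps / (4 * PI)] over a length [2 * PI] add up to [eps]. *)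
  assert (He : 0 < eps / (4 * PI)) by (apply Rdiv_lt_0_compat; [apply cond_pos | lra]).
  destruct (uniform_continuity_2d_1d' (fun r t => Re (G (r, t))) 0 (2 * PI) r0) with (eps := mkposreal _ He)
    as [d1 Hd1].
  { intros t _; apply continuity_2d_pt_filterlim.
    exact (continuous_Re G (r0, t) (HG t)). }
  destruct (uniform_continuity_2d_1d' (fun r t => Im (G (r, t))) 0 (2 * PI) r0) with (eps := mkposreal _ He)
    as [d2 Hd2].
  { intros t _; apply continuity_2d_pt_filterlim.
    exact (continuous_Im G (r0, t) (HG t)). }
  cbn [pos] in Hd1, Hd2.
  assert (Hd : 0 < Rmin (Rmin d1 d2) (Rmin r0 (1 - r0))).
  { repeat apply Rmin_pos; try apply cond_pos; lra. }
  exists (mkposreal _ Hd); simpl; intros r Hr.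
  assert (Hr1 : Rabs (r - r0) < d1) by (eapply Rlt_le_trans; [exact Hr|]; eapply Rle_trans; apply Rmin_l).
  assert (Hr2 : Rabs (r - r0) < d2) by (eapply Rlt_le_trans; [exact Hr|]; eapply Rle_trans; [apply Rmin_l | apply Rmin_r]).
  assert (Hr3 : Rabs (r - r0) < r0) by (eapply Rlt_le_trans; [exact Hr|]; eapply Rle_trans; [apply Rmin_r | apply Rmin_l]).
  assert (Hr4 : Rabs (r - r0) < 1 - r0) by (eapply Rlt_le_trans; [exact Hr|]; eapply Rle_trans; [apply Rmin_r | apply Rmin_r]).
  apply Rabs_def2 in Hr1, Hr2, Hr3, Hr4.
  replace (eps : R) with ((2 * PI - 0) * (eps / (4 * PI) + eps / (4 * PI))) by (field; lra).
  apply (is_CInt_norm_le_const (fun t => G (r, t) - G (r0, t))%C).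
  - lra.
  - intros t Ht.
    eapply Rle_trans; [apply Cmod_le_abs_sum|].
    apply Rplus_le_compat; apply Rlt_le.
    + apply (Hd1 t r0 t r); try lra; replace (t - t) with 0 by ring; rewrite Rabs_R0; apply cond_pos.
    + apply (Hd2 t r0 t r); try lra; replace (t - t) with 0 by ring; rewrite Rabs_R0; apply cond_pos.
  - apply is_CInt_minus; apply is_CInt_circle_int; trivial; lra.
Qed.

Lemma Cmod_le_all_eps_0 (z : C) : (forall eps : posreal, Cmod z <= eps) -> z = 0.
Proof.
  intros H; apply Cmod_eq_0, Rle_antisym; [|apply Cmod_ge_0].
  apply le_epsilon; intros e He; specialize (H (mkposreal e He)); simpl in H; lra.
Qed.

Lemma cauchy_circle (g : C -> C) (w : C) (r : R) :
  continuous_on_disk g ->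
  (forall z, Cmod z < 1 -> z <> w -> C_differentiable g z) ->
  0 < r < 1 -> circle_int g r = 0.
Proof.
  intros Hc Hd.
  set (rho := Cmod w).
  assert (Heq : forall r1 r2, 0 < r1 -> r1 <= r2 -> r2 < 1 ->
    (forall s, r1 <= s <= r2 -> s <> rho) -> circle_int g r1 = circle_int g r2).
  { intros r1 r2 H1 H12 H2 Hs; apply circle_int_eq; trivial.
    intros z Hz; apply Hd; [lra|]; intros ->; apply (Hs rho); trivial. }
  (* The case [rho <= 0] means [w = 0]: then no circle of positive radius meets the exceptional
     point, and every radius can be shrunk towards [0]. *)
  assert (HA : forall r, 0 < r < 1 -> (r < rho \/ rho <= 0) -> circle_int g r = 0).
  { intros s Hs Hor; apply Cmod_le_all_eps_0; intros eps.
    destruct (circle_int_small g eps Hc) as [d Hsm].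
    pose proof (cond_pos d).
    assert (Hm : 0 < Rmin (d / 2) s) by (apply Rmin_pos; lra).
    rewrite <- (Heq (Rmin (d / 2) s) s); trivial.
    - apply Hsm; split; [assumption|]; pose proof (Rmin_l (d / 2) s); lra.
    - apply Rmin_r.
    - lra.
    - intros u Hu; lra. }
  assert (HB : 0 < rho < 1 -> circle_int g rho = 0).
  { intros Hrho; apply Cmod_le_all_eps_0; intros eps.
    destruct (circle_int_continuous g rho eps Hc Hrho) as [d Hcont].
    pose proof (cond_pos d).
    assert (Hm : 0 < Rmin (d / 2) (rho / 2)) by (apply Rmin_pos; lra).
    pose proof (Rmin_l (d / 2) (rho / 2)); pose proof (Rmin_r (d / 2) (rho / 2)).
    set (m := Rmin (d / 2) (rho / 2)) in *.
    specialize (Hcont (rho - m)).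
    rewrite (HA (rho - m)) in Hcont by lra.
    rewrite <- (Cmod_opp (circle_int g rho)).
    replace (- circle_int g rho)%C with (0 - circle_int g rho)%C by ring.
    apply Hcont; apply Rabs_def1; lra. }
  intros Hr.
  destruct (Rlt_dec r rho) as [Hlt | Hge]; [apply HA; auto|].
  destruct (Rle_dec rho 0) as [Hle | Hgt]; [apply HA; auto|].
  destruct (Req_dec rho r) as [E | Hne]; [rewrite <- E; apply HB; lra|].
  (* Beyond the exceptional radius the integral is again constant, so it equals its limit as the
     radius decreases to [rho], which is [0] by [HB]. *)
  apply Cmod_le_all_eps_0; intros eps.
  destruct (circle_int_continuous g rho eps Hc) as [d Hcont]; [lra|].
  pose proof (cond_pos d).
  assert (Hm : 0 < Rmin (d / 2) (r - rho)) by (apply Rmin_pos; lra).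
  pose proof (Rmin_l (d / 2) (r - rho)); pose proof (Rmin_r (d / 2) (r - rho)).
  set (m := Rmin (d / 2) (r - rho)) in *.
  rewrite <- (Heq (rho + m) r); try lra; [|intros s Hs; lra].
  specialize (Hcont (rho + m)); rewrite HB in Hcont by lra.
  replace (circle_int g (rho + m)) with (circle_int g (rho + m) - 0)%C by ring.
  apply Hcont; apply Rabs_def1; lra.
Qed.

(** * Cauchy's integral formula *)

Lemma C_differentiable_ext (f g : C -> C) (z : C) (d : posreal) :
  (forall y, Cmod (y - z)%C < d -> f y = g y) ->
  C_differentiable f z -> C_differentiable g z.
Proof.
  intros H [l Hl]; exists l.
  apply (is_derive_ext_loc (K := C_AbsRing) (V := C_NormedModule) f g z l); [|exact Hl].
  exists d; intros y Hy; apply H; exact Hy.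
Qed.

Lemma C_differentiable_const (c z : C) : C_differentiable (fun _ => c) z.
Proof.
  eexists; apply (is_derive_const (K := C_AbsRing) (V := C_NormedModule)).
Qed.

Lemma is_derive_Cid (z : C) : @is_derive C_AbsRing C_NormedModule (fun x => x) z (RtoC 1).
Proof.
  apply is_derive_C_AbsRing, (is_derive_id (K := C_AbsRing)).
Qed.

Lemma C_differentiable_id (z : C) : C_differentiable (fun x => x) z.
Proof.
  eexists; apply is_derive_Cid.
Qed.

Lemma C_differentiable_minus (f g : C -> C) (z : C) :
  C_differentiable f z -> C_differentiable g z -> C_differentiable (fun x => f x - g x)%C z.
Proof.
  intros [l Hl] [m Hm]; exists (l - m)%C.
  exact (is_derive_minus (K := C_AbsRing) (V := C_NormedModule) f g z l m Hl Hm).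
Qed.

Lemma C_differentiable_mult (f g : C -> C) (z : C) :
  C_differentiable f z -> C_differentiable g z -> C_differentiable (fun x => f x * g x)%C z.
Proof.
  intros [l Hl] [m Hm]; eexists; apply (is_derive_Cmult f g z l m Hl Hm).
Qed.

Lemma C_differentiable_pow (f : C -> C) (n : nat) (z : C) :
  C_differentiable f z -> C_differentiable (fun x => f x ^ n)%C z.
Proof.
  intros Hf; induction n as [|n IH]; simpl.
  - apply C_differentiable_const.
  - apply C_differentiable_mult; assumption.
Qed.

Lemma is_derive_Cinv (z : C) : z <> 0 ->
  @is_derive C_AbsRing C_NormedModule (fun x => / x)%C z (- / (z * z))%C.
Proof.
  intros Hz; apply is_derive_C_iff; intros eps.
  pose proof (proj1 (Cmod_gt_0 _) Hz) as Hm; pose proof (cond_pos eps) as Heps.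
  set (m := Cmod z) in *.
  assert (Hm3 : 0 < m * m * m) by (repeat apply Rmult_lt_0_compat; assumption).
  assert (Hd : 0 < Rmin (m / 2) (eps * (m * m * m) / 2)).
  { apply Rmin_pos; [lra|]. apply Rdiv_lt_0_compat; [apply Rmult_lt_0_compat; assumption | lra]. }
  exists (mkposreal _ Hd); simpl; intros y Hy.
  pose proof (Rmin_l (m / 2) (eps * (m * m * m) / 2)).
  pose proof (Rmin_r (m / 2) (eps * (m * m * m) / 2)).
  assert (H3 : m / 2 < Cmod y).
  { pose proof (Cmod_triangle_rev z y) as T; rewrite Cmod_sub_sym in T; fold m in T; lra. }
  assert (Hy0 : y <> 0) by (apply Cmod_gt_0; lra).
  replace (/ y - / z - (y - z) * - / (z * z))%C
    with ((y - z) * ((y - z) / (y * (z * z))))%C by (field; split; assumption).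
  rewrite Cmod_mult, (Rmult_comm eps).
  apply Rmult_le_compat_l; [apply Cmod_ge_0|].
  rewrite Cmod_div by (repeat apply Cmult_neq_0; assumption).
  rewrite !Cmod_mult; fold m.
  apply Rle_div_l; [repeat apply Rmult_lt_0_compat; lra|].
  apply Rle_trans with (eps * (m / 2 * (m * m))); [lra|].
  apply Rmult_le_compat_l; [lra|]; apply Rmult_le_compat_r; [|lra].
  apply Rlt_le, Rmult_lt_0_compat; assumption.
Qed.

Lemma C_differentiable_div (f g : C -> C) (z : C) :
  C_differentiable f z -> C_differentiable g z -> g z <> 0 ->
  C_differentiable (fun x => f x / g x)%C z.
Proof.
  intros Hf [m Hm] Hz; apply C_differentiable_mult; [exact Hf|].
  eexists; apply (is_derive_Ccomp (fun x => / x)%C g z _ m (is_derive_Cinv _ Hz) Hm).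
Qed.

(** The value at [w] makes the quotient continuous there; differentiability at [w] is not known at
    this stage, which is why [cauchy_circle] admits one exceptional point. *)
Definition difference_quotient (f : C -> C) (w z : C) : C :=
  if Ceq_dec z w then C_derive f w else ((f z - f w) / (z - w))%C.

Lemma C_differentiable_difference_quotient (f : C -> C) (w z : C) :
  z <> w -> C_differentiable f z -> C_differentiable (difference_quotient f w) z.
Proof.
  intros Hzw Hf.
  assert (Hd : 0 < Cmod (z - w)%C) by (apply Cmod_gt_0, Cminus_eq_contra, Hzw).
  apply (C_differentiable_ext (fun x => (f x - f w) / (x - w))%C _ z (mkposreal _ Hd)).
  - simpl; intros y Hy; unfold difference_quotient.
    destruct (Ceq_dec y w) as [-> | _]; [|reflexivity].
    rewrite Cmod_sub_sym in Hy; lra.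
  - apply C_differentiable_div.
    + apply C_differentiable_minus; [assumption | apply C_differentiable_const].
    + apply C_differentiable_minus; [apply C_differentiable_id | apply C_differentiable_const].
    + apply Cminus_eq_contra, Hzw.
Qed.

Lemma continuous_difference_quotient (f : C -> C) (w : C) :
  holomorphic_on_disk f -> Cmod w < 1 -> continuous_on_disk (difference_quotient f w).
Proof.
  intros Hf Hw z Hz.
  destruct (Ceq_dec z w) as [-> | Hne];
    [| apply C_differentiable_continuous, C_differentiable_difference_quotient; auto].
  apply continuous_C_disk; intros eps; pose proof (cond_pos eps) as Heps.
  assert (He : 0 < eps / 2) by lra.
  destruct (proj1 (is_derive_C_iff f w (C_derive f w)) (C_derive_correct f w 0 (Hf w Hw))
    (mkposreal _ He)) as [d Hd].
  cbn [pos] in Hd.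
  exists d; intros y Hy; specialize (Hd y Hy).
  unfold difference_quotient.
  destruct (Ceq_dec w w) as [_ | []]; [|reflexivity].
  destruct (Ceq_dec y w) as [-> | Hyw].
  - replace (C_derive f w - C_derive f w)%C with (RtoC 0) by ring; rewrite Cmod_0; lra.
  - pose proof (Cminus_eq_contra _ _ Hyw) as Hn; pose proof (proj1 (Cmod_gt_0 _) Hn) as Hpos.
    replace ((f y - f w) / (y - w) - C_derive f w)%C
      with ((f y - f w - (y - w) * C_derive f w) / (y - w))%C by (field; assumption).
    rewrite Cmod_div by assumption.
    apply Rle_lt_trans with (eps / 2); [|lra].
    apply Rle_div_l; assumption.
Qed.

Lemma holomorphic_continuous_on_disk (f : C -> C) :
  holomorphic_on_disk f -> continuous_on_disk f.
Proof.
  intros Hf z Hz; apply C_differentiable_continuous, Hf, Hz.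
Qed.

(** * Cauchy coefficients and the Taylor expansion *)

Lemma circ_neq_0 (r t : R) : 0 < r -> circ r t <> 0.
Proof.
  intros Hr; apply Cmod_gt_0; rewrite Cmod_circ; lra.
Qed.

(** One factor [circ r t] comes from [dz], so the exponents that give [0] start at [1]. *)
Lemma is_CInt_circle_mult_pow (f : C -> C) (r : R) (n : nat) :
  holomorphic_on_disk f -> 0 < r < 1 ->
  is_CInt (fun t => f (circ r t) * circ r t ^ S n)%C 0 (2 * PI) 0.
Proof.
  intros Hf Hr; pose proof PI_RGT_0.
  assert (Hg : holomorphic_on_disk (fun z => f z * z ^ n)%C).
  { intros z Hz; apply C_differentiable_mult; [apply Hf, Hz|].
    apply C_differentiable_pow, C_differentiable_id. }
  rewrite <- (cauchy_circle (fun z => f z * z ^ n)%C 0 r); trivial.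
  - apply is_CInt_ext with (fun t => f (circ r t) * circ r t ^ n * circ r t)%C; [lra| |].
    + intros t _; simpl; ring.
    + apply is_CInt_circle_int; [apply holomorphic_continuous_on_disk; assumption | lra].
  - apply holomorphic_continuous_on_disk; assumption.
  - intros z Hz _; apply Hg, Hz.
Qed.

Lemma is_CInt_conj (f : R -> C) (a b : R) (l : C) :
  is_CInt f a b l -> is_CInt (fun t => Cconj (f t)) a b (Cconj l).
Proof.
  intros H; apply is_CInt_pair; simpl.
  - exact (is_CInt_Re _ _ _ _ H).
  - exact (is_RInt_opp (V := R_NormedModule) _ _ _ _ (is_CInt_Im _ _ _ _ H)).
Qed.

(** On a circle about [0] inversion is conjugation up to a positive factor, so negative powers
    integrate as conjugates of positive ones. *)
Lemma Cinv_circ (r t : R) : 0 < r -> (/ circ r t)%C = (RtoC (/ r ^ 2) * Cconj (circ r t))%C.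
Proof.
  intros Hr; pose proof (circ_neq_0 r t Hr) as Hn.
  assert (E : (circ r t * Cconj (circ r t))%C = RtoC (r ^ 2)).
  { rewrite <- Cmod2_conj, Cmod_circ by lra; reflexivity. }
  rewrite RtoC_inv by (apply pow_nonzero; lra).
  rewrite <- E; field; split; [|assumption].
  apply Cmod_gt_0; rewrite Cmod_conj, Cmod_circ; lra.
Qed.

(** The parametrized form of the integral of [f(z) / z^(n+1)] divided by [2 PI i]. It depends on [r]
    until it is identified with [coef]. *)
Definition cauchy_coef (f : C -> C) (r : R) (n : nat) : C :=
  (RtoC (/ (2 * PI)) * CInt (fun t => f (circ r t) * / circ r t ^ n) 0 (2 * PI))%C.

Lemma is_CInt_cauchy_coef (f : C -> C) (r : R) (n : nat) :
  continuous_on_disk f -> 0 < r < 1 ->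
  is_CInt (fun t => f (circ r t) * / circ r t ^ n)%C 0 (2 * PI)
    (RtoC (2 * PI) * cauchy_coef f r n)%C.
Proof.
  intros Hf Hr; pose proof PI_RGT_0.
  unfold cauchy_coef; rewrite Cmult_assoc, <- RtoC_mult, Rinv_r, Cmult_1_l by lra.
  apply CInt_correct; [lra|]; intros t _.
  apply continuous_Cmult; [apply continuous_on_circle; trivial; lra|].
  apply continuous_Cinv; [apply continuous_Cpow, continuous_circ|].
  apply Cpow_nz, circ_neq_0; lra.
Qed.

Lemma cauchy_coef_1 (r : R) (n : nat) : 0 < r < 1 ->
  cauchy_coef (fun _ => 1) r n = match n with O => 1 | S _ => 0 end.
Proof.
  intros Hr; pose proof PI_RGT_0; unfold cauchy_coef; destruct n as [|n].
  - rewrite (is_CInt_unique _ _ _ (RtoC (2 * PI - 0) * 1)%C).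
    + rewrite Rminus_0_r, Cmult_1_r, <- RtoC_mult, Rinv_l by lra; reflexivity.
    + apply is_CInt_ext with (fun _ => RtoC 1); [lra | | apply is_CInt_const].
      intros t _; simpl; field; exact C1_nz.
  - rewrite (is_CInt_unique _ _ _ (RtoC (/ r ^ 2) ^ S n * Cconj 0)%C).
    + rewrite Cmult_comm; unfold Cconj; simpl; rewrite Ropp_0; fold (RtoC 0); ring.
    + apply is_CInt_ext with (fun t => RtoC (/ r ^ 2) ^ S n * Cconj (1 * circ r t ^ S n))%C; [lra | |].
      * intros t _; rewrite <- Cpow_inv by (apply circ_neq_0; lra).
        rewrite Cinv_circ, Cpow_mult_l, !Cmult_1_l, Cpow_conj by lra; reflexivity.
      * apply is_CInt_mult, is_CInt_conj.
        apply (is_CInt_circle_mult_pow (fun _ => 1)); [|assumption].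
        intros z _; apply C_differentiable_const.
Qed.

Definition is_Cseries (a : nat -> C) (l : C) : Prop :=
  @is_series C_AbsRing C_NormedModule a l.

Lemma is_Cseries_iff (a : nat -> C) (l : C) :
  is_Cseries a l <->
  forall eps : posreal, exists N, forall n, (N <= n)%nat ->
    Cmod (sum_n (G := C_NormedModule) a n - l)%C < eps.
Proof.
  unfold is_Cseries, is_series.
  exact (filterlim_locally_ball_norm (K := C_AbsRing) (U := C_NormedModule) _ _).
Qed.

(** The finite geometric sum in [w / z] approximates [z / (z - w)], so this is Cauchy's formula with
    a truncated kernel. *)
Lemma is_CInt_partial_sum (f : C -> C) (r : R) (w : C) (N : nat) :
  continuous_on_disk f -> 0 < r < 1 ->
  is_CInt (fun t => f (circ r t) * sum_n (G := C_NormedModule) (fun n => (w / circ r t) ^ n)%C N)%C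
    0 (2 * PI) (RtoC (2 * PI) * sum_n (G := C_NormedModule) (fun n => cauchy_coef f r n * w ^ n)%C N)%C.
Proof.
  intros Hf Hr; pose proof PI_RGT_0.
  assert (Hn : forall n, is_CInt (fun t => f (circ r t) * (w / circ r t) ^ n)%C 0 (2 * PI)
    (RtoC (2 * PI) * (cauchy_coef f r n * w ^ n))%C).
  { intros n.
    replace (RtoC (2 * PI) * (cauchy_coef f r n * w ^ n))%C
      with (w ^ n * (RtoC (2 * PI) * cauchy_coef f r n))%C by ring.
    apply is_CInt_ext with (fun t => w ^ n * (f (circ r t) * / circ r t ^ n))%C; [lra | |].
    - intros t _; unfold Cdiv; rewrite Cpow_mult_l, Cpow_inv by (apply circ_neq_0; lra); ring.
    - apply is_CInt_mult, is_CInt_cauchy_coef; assumption. }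
  induction N as [|N IH].
  - rewrite sum_O; apply is_CInt_ext with (2 := fun t _ => f_equal _ (eq_sym (sum_O (G := C_NormedModule) _))); [lra|].
    apply Hn.
  - rewrite sum_Sn.
    apply is_CInt_ext with (2 := fun t _ => f_equal _ (eq_sym (sum_Sn (G := C_NormedModule) _ _))); [lra|].
    unfold plus; simpl.
    rewrite Cmult_plus_distr_l.
    apply is_CInt_ext with (2 := fun t _ => eq_sym (Cmult_plus_distr_l _ _ _)); [lra|].
    apply is_CInt_plus; [exact IH | apply Hn].
Qed.

Lemma sum_n_Cgeom (q : C) (N : nat) :
  (sum_n (G := C_NormedModule) (fun n => q ^ n)%C N * (1 - q))%C = (1 - q ^ S N)%C.
Proof.
  induction N as [|N IH].
  - rewrite sum_O; simpl; ring.
  - rewrite sum_Sn.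
    change (((sum_n (G := C_NormedModule) (fun n => q ^ n) N + q ^ S N) * (1 - q))%C = (1 - q ^ S (S N))%C).
    rewrite Cmult_plus_distr_r, IH; simpl; ring.
Qed.

Lemma continuous_Cmod (f : R -> C) (t : R) :
  continuous f t -> continuous (fun s => Cmod (f s)) t.
Proof.
  intros Hf; apply filterlim_locally; intros eps.
  generalize (proj1 (continuous_C_iff f t) Hf eps); apply filter_imp; intros s Hs.
  change (Rabs (Cmod (f s) - Cmod (f t)) < eps).
  pose proof (Cmod_triangle_rev (f s) (f t)); pose proof (Cmod_triangle_rev (f t) (f s)) as H2.
  rewrite Cmod_sub_sym in H2; apply Rabs_def1; lra.
Qed.

Lemma continuous_C_bounded (f : R -> C) (a b : R) :
  a <= b -> (forall t, a <= t <= b -> continuous f t) ->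
  exists K, 0 <= K /\ forall t, a <= t <= b -> Cmod (f t) <= K.
Proof.
  intros Hab Hf.
  destruct (continuity_ab_maj (fun t => Cmod (f t)) a b Hab) as [m [Hm _]].
  { intros t Ht; apply continuity_pt_filterlim; exact (continuous_Cmod f t (Hf t Ht)). }
  exists (Cmod (f m)); split; [apply Cmod_ge_0 | exact Hm].
Qed.

Lemma sum_cauchy_coef_1 (r : R) (w : C) (N : nat) : 0 < r < 1 ->
  sum_n (G := C_NormedModule) (fun n => cauchy_coef (fun _ => 1) r n * w ^ n)%C N = RtoC 1.
Proof.
  intros Hr; induction N as [|N IH].
  - rewrite sum_O, cauchy_coef_1 by assumption; simpl; ring.
  - rewrite sum_Sn, IH, cauchy_coef_1 by assumption.
    change (1 + 0 * w ^ S N = 1)%C; ring.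
Qed.

(** Cauchy's formula and its expansion are obtained at once: the truncated formula for [f], minus
    [f w] times the one for the constant [1], minus the vanishing integral of the difference
    quotient. The integral of [1 / (z - w)] never has to be computed. *)
Lemma taylor (f : C -> C) (r : R) (w : C) :
  holomorphic_on_disk f -> 0 < r < 1 -> Cmod w < r ->
  is_Cseries (fun n => cauchy_coef f r n * w ^ n)%C (f w).
Proof.
  intros Hf Hr Hw; pose proof PI_RGT_0 as Hpi.
  set (g := difference_quotient f w).
  assert (Hg : continuous_on_disk g) by (apply continuous_difference_quotient; trivial; lra).
  assert (Hg0 : circle_int g r = 0).
  { apply (cauchy_circle g w); trivial.
    intros z Hz Hzw; apply C_differentiable_difference_quotient; auto. }
  pose proof (is_CInt_circle_int g r Hg ltac:(lra)) as HI; rewrite Hg0 in HI.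
  assert (Hne : forall t, circ r t <> w).
  { intros t E; rewrite <- E, Cmod_circ in Hw; lra. }
  destruct (continuous_C_bounded (fun t => g (circ r t) * circ r t)%C 0 (2 * PI)) as [K [HK0 HK]].
  { lra. }
  { intros t _; apply continuous_Cmult; [apply continuous_on_circle; trivial; lra | apply continuous_circ]. }
  set (q := Cmod w / r).
  assert (Hq : 0 <= q < 1).
  { split; [apply Rdiv_le_0_compat; [apply Cmod_ge_0 | lra] |].
    apply Rlt_div_l; lra. }
  set (S := fun N => sum_n (G := C_NormedModule) (fun n => cauchy_coef f r n * w ^ n)%C N).
  assert (HS : forall N, Cmod (S N - f w)%C <= K * q ^ (N + 1)).
  { intros N.
    pose proof (is_CInt_partial_sum f r w N (holomorphic_continuous_on_disk f Hf) Hr) as H1.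
    assert (H2 : continuous_on_disk (fun _ => 1)) by (intros z _; apply continuous_const).
    pose proof (is_CInt_mult (f w) _ _ _ _ (is_CInt_partial_sum _ r w N H2 Hr)) as H3.
    rewrite (sum_cauchy_coef_1 r w N Hr) in H3; fold (S N) in H1.
    pose proof (is_CInt_minus _ _ _ _ _ _ (is_CInt_minus _ _ _ _ _ _ H1 H3) HI) as H4.
    assert (H5 : Cmod (RtoC (2 * PI) * S N - f w * (RtoC (2 * PI) * 1) - 0)%C
      <= (2 * PI - 0) * (K * q ^ (N + 1))).
    { refine (is_CInt_norm_le_const _ _ _ _ _ _ _ H4); [lra|].
      intros t Ht; cbv beta.
      set (z := circ r t); set (G := sum_n _ N).
      assert (Hz : z <> 0) by (apply circ_neq_0; lra).
      assert (Hzw : (z - w)%C <> 0) by (apply Cminus_eq_contra, Hne).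
      assert (HG : (G * (z - w))%C = (z * (1 - (w / z) ^ Datatypes.S N))%C).
      { rewrite <- (sum_n_Cgeom (w / z) N); fold G; field; assumption. }
      assert (Hgz : (g z * (z - w))%C = (f z - f w)%C).
      { unfold g, difference_quotient; destruct (Ceq_dec z w) as [E | _]; [destruct (Hne t E)|].
        field; assumption. }
      (* Since [f z - f w = g z * (z - w)] and [G * (z - w) = z * (1 - (w / z) ^ (N + 1))], all
         terms cancel except the geometric tail, of modulus at most [K * q ^ (N + 1)]. *)
      replace (f z * G - f w * (1 * G) - g z * z)%C with (- (g z * z) * (w / z) ^ Datatypes.S N)%C.
      - rewrite Cmod_mult, Cmod_opp, Cmod_pow, Cmod_div by assumption.
        unfold z at 3; rewrite Cmod_circ by lra; fold q.
        rewrite Nat.add_1_r; apply Rmult_le_compat_r; [apply pow_le; lra | apply HK; assumption].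
      - replace (f z * G - f w * (1 * G) - g z * z)%C with ((f z - f w) * G - g z * z)%C by ring.
        rewrite <- Hgz.
        replace (g z * (z - w) * G)%C with (g z * (G * (z - w)))%C by ring.
        rewrite HG; ring. }
    replace (RtoC (2 * PI) * S N - f w * (RtoC (2 * PI) * 1) - 0)%C
      with (RtoC (2 * PI) * (S N - f w))%C in H5 by ring.
    rewrite Cmod_mult, Cmod_R, Rabs_right, Rminus_0_r in H5 by lra.
    apply Rmult_le_reg_l with (2 * PI); [lra | exact H5]. }
  apply is_Cseries_iff; intros eps.
  assert (Hlim : is_lim_seq (fun n => K * q ^ n) (K * 0)).
  { apply (is_lim_seq_scal_l _ K 0), is_lim_seq_geom; rewrite Rabs_right; lra. }
  rewrite Rmult_0_r in Hlim; apply is_lim_seq_spec in Hlim.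
  destruct (Hlim eps) as [N HN]; exists N; intros n Hn.
  specialize (HN (n + 1)%nat ltac:(lia)); rewrite Rminus_0_r in HN.
  eapply Rle_lt_trans; [apply HS|].
  eapply Rle_lt_trans; [apply Rle_abs | exact HN].
Qed.

(** * Complex power series *)

Lemma Cseries_unique (a : nat -> C) (l1 l2 : C) :
  is_Cseries a l1 -> is_Cseries a l2 -> l1 = l2.
Proof.
  intros H1 H2.
  exact (filterlim_locally_unique (K := C_AbsRing) (V := C_NormedModule) (F := eventually) _ l1 l2 H1 H2).
Qed.

Lemma is_Cseries_Cmod_le (a : nat -> C) (b : nat -> R) (la : C) (lb : R) :
  (forall n, Cmod (a n) <= b n) -> is_Cseries a la -> is_series b lb -> Cmod la <= lb.
Proof.
  intros Hab Ha Hb; apply le_epsilon; intros e He.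
  assert (He2 : 0 < e / 2) by lra.
  destruct (proj1 (is_Cseries_iff a la) Ha (mkposreal _ He2)) as [N1 H1].
  destruct (proj1 (filterlim_locally _ _) Hb (mkposreal _ He2)) as [N2 H2].
  set (n := (N1 + N2)%nat).
  specialize (H1 n ltac:(lia)); specialize (H2 n ltac:(lia)).
  change (Rabs (sum_n b n - lb) < e / 2) in H2; simpl in H1.
  apply Rabs_def2 in H2.
  pose proof (norm_sum_n_m (K := C_AbsRing) (V := C_NormedModule) a 0 n) as H3.
  change (Cmod (sum_n (G := C_NormedModule) a n) <= sum_n_m (fun k => Cmod (a k)) 0 n) in H3.
  pose proof (sum_n_m_le (fun k => Cmod (a k)) b 0 n Hab) as H4.
  fold (sum_n b n) in H4.
  pose proof (Cmod_triangle_rev la (sum_n (G := C_NormedModule) a n)) as H5.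
  rewrite Cmod_sub_sym in H5; lra.
Qed.

Lemma ex_Cseries_le (a : nat -> C) (b : nat -> R) :
  (forall n, Cmod (a n) <= b n) -> ex_series b -> exists l, is_Cseries a l.
Proof.
  exact (ex_series_le (K := C_AbsRing) (V := C_CompleteNormedModule) a b).
Qed.

(** Applied at a point of modulus [rho'], this bounds the coefficients of a power series by
    [K / rho' ^ n]. *)
Lemma is_Cseries_bounded (a : nat -> C) (l : C) :
  is_Cseries a l -> exists K, forall n, Cmod (a n) <= K.
Proof.
  intros H.
  destruct (proj1 (is_Cseries_iff a l) H (mkposreal 1 Rlt_0_1)) as [N HN]; simpl in HN.
  assert (Hfin : forall M, exists K, forall n, (n <= M)%nat -> Cmod (a n) <= K).
  { intros M; induction M as [|M [K IH]].
    - exists (Cmod (a O)); intros n Hn; replace n with O by lia; lra.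
    - exists (Rmax K (Cmod (a (S M)))); intros n Hn.
      destruct (Nat.eq_dec n (S M)) as [-> | Hne]; [apply Rmax_r|].
      eapply Rle_trans; [apply IH; lia | apply Rmax_l]. }
  destruct (Hfin (S N)) as [K HK].
  exists (Rmax K 2); intros n.
  destruct (Nat.le_gt_cases n (S N)) as [Hle | Hlt].
  - eapply Rle_trans; [apply HK, Hle | apply Rmax_l].
  - eapply Rle_trans; [|apply Rmax_r].
    destruct n as [|n]; [lia|].
    pose proof (HN (S n) ltac:(lia)) as H1; pose proof (HN n ltac:(lia)) as H2.
    rewrite sum_Sn in H1.
    change (Cmod ((sum_n (G := C_NormedModule) a n + a (S n)) - l)%C < 1) in H1.
    set (s := sum_n (G := C_NormedModule) a n) in *.
    replace (a (S n)) with ((s + a (S n) - l) - (s - l))%C by ring.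
    eapply Rle_trans; [apply Cmod_triangle|]; rewrite Cmod_opp; lra.
Qed.

Lemma is_Cseries_plus (a b : nat -> C) (la lb : C) :
  is_Cseries a la -> is_Cseries b lb -> is_Cseries (fun n => a n + b n)%C (la + lb)%C.
Proof.
  exact (is_series_plus (K := C_AbsRing) (V := C_NormedModule) a b la lb).
Qed.

Lemma is_Cseries_mult (c : C) (a : nat -> C) (la : C) :
  is_Cseries a la -> is_Cseries (fun n => c * a n)%C (c * la)%C.
Proof.
  exact (is_series_scal_l (K := C_AbsRing) (V := C_NormedModule) c a la).
Qed.

Lemma is_Cseries_minus (a b : nat -> C) (la lb : C) :
  is_Cseries a la -> is_Cseries b lb -> is_Cseries (fun n => a n - b n)%C (la - lb)%C.
Proof.
  exact (is_series_minus (K := C_AbsRing) (V := C_NormedModule) a b la lb).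
Qed.

Lemma is_Cseries_ext (a b : nat -> C) (l : C) :
  (forall n, a n = b n) -> is_Cseries a l -> is_Cseries b l.
Proof.
  exact (is_series_ext (K := C_AbsRing) (V := C_NormedModule) a b l).
Qed.

Lemma is_Cseries_shift (a : nat -> C) (l : C) :
  is_Cseries a l <-> is_Cseries (fun n => a (S n)) (l - a O)%C.
Proof.
  split; intros H.
  - refine (is_series_incr_1 (K := C_AbsRing) (V := C_NormedModule) a (l - a O)%C _).
    refine (eq_ind l (fun x => @is_series C_AbsRing C_NormedModule a x) H _ _).
    change (l = (l - a O) + a O)%C; ring.
  - apply (is_series_decr_1 (K := C_AbsRing) (V := C_NormedModule) a).
    exact H.
Qed.

Definition pow_derivative (z : C) (n : nat) : C :=
  match n with O => 0 | S m => (RtoC (INR n) * z ^ m)%C end.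

(** Induction through [D (n+1) = (z + h) * D n + h^2 * n z^(n-1)], with [n^2 + n <= (n + 1)^2]. The
    factor [rho ^ 2] on the left stands for the exponent [n - 2] on the right. *)
Lemma pow_second_order (z h : C) (rho : R) (n : nat) :
  0 < rho -> Cmod z <= rho -> Cmod (z + h)%C <= rho ->
  rho ^ 2 * Cmod ((z + h) ^ n - z ^ n - h * pow_derivative z n)%C <=
  Cmod h ^ 2 * (INR n ^ 2 * rho ^ n).
Proof.
  intros Hrho Hz Hzh.
  set (D := fun n => ((z + h) ^ n - z ^ n - h * pow_derivative z n)%C).
  assert (HE : forall n, rho * Cmod (pow_derivative z n) <= INR n * rho ^ n).
  { intros [|m].
    - simpl; rewrite Cmod_0; lra.
    - unfold pow_derivative; rewrite Cmod_mult, Cmod_pow, Cmod_R, Rabs_right by (apply Rle_ge, pos_INR).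
      replace (INR (S m) * rho ^ S m) with (rho * (INR (S m) * rho ^ m)) by (simpl pow; ring).
      apply Rmult_le_compat_l; [lra|]; apply Rmult_le_compat_l; [apply pos_INR|].
      apply pow_incr; split; [apply Cmod_ge_0 | assumption]. }
  assert (Hrec : forall n, D (S n) = ((z + h) * D n + h * (h * pow_derivative z n))%C).
  { intros m; unfold D.
    replace (pow_derivative z (S m)) with (z ^ m + z * pow_derivative z m)%C.
    - simpl; ring.
    - destruct m as [|m]; unfold pow_derivative.
      + simpl; ring.
      + rewrite (S_INR (S m)), RtoC_plus; simpl; ring. }
  change (rho ^ 2 * Cmod (D n) <= Cmod h ^ 2 * (INR n ^ 2 * rho ^ n)).
  pose proof (Cmod_ge_0 h) as Hh.
  induction n as [|n IH].
  - unfold D; simpl; replace (1 - 1 - h * 0)%C with (RtoC 0) by ring; rewrite Cmod_0; lra.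
  - rewrite Hrec.
    apply Rle_trans with (rho * (rho ^ 2 * Cmod (D n)) + rho * (Cmod h ^ 2 * (rho * Cmod (pow_derivative z n)))).
    { apply Rle_trans with (rho ^ 2 * (rho * Cmod (D n) + Cmod h * (Cmod h * Cmod (pow_derivative z n)))); [|right; ring].
      apply Rmult_le_compat_l; [apply pow2_ge_0|].
      eapply Rle_trans; [apply Cmod_triangle|]; rewrite !Cmod_mult.
      apply Rplus_le_compat_r, Rmult_le_compat_r; [apply Cmod_ge_0 | assumption]. }
    apply Rle_trans with (rho * (Cmod h ^ 2 * (INR n ^ 2 * rho ^ n)) + rho * (Cmod h ^ 2 * (INR n * rho ^ n))).
    { apply Rplus_le_compat; (apply Rmult_le_compat_l; [lra|]); [exact IH|].
      apply Rmult_le_compat_l; [apply pow2_ge_0 | apply HE]. }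
    rewrite S_INR.
    replace (rho * (Cmod h ^ 2 * (INR n ^ 2 * rho ^ n)) + rho * (Cmod h ^ 2 * (INR n * rho ^ n)))
      with (Cmod h ^ 2 * ((INR n ^ 2 + INR n) * rho ^ S n)) by (simpl pow; ring).
    apply Rmult_le_compat_l; [apply pow2_ge_0|].
    apply Rmult_le_compat_r; [apply pow_le; lra|].
    pose proof (pos_INR n); simpl; lra.
Qed.

(** The geometric series differentiated twice, whose radius of convergence is still [1]. It
    dominates both the differentiated series and the second-order remainders. *)
Lemma ex_series_quadratic_geom (q : R) : 0 <= q < 1 ->
  ex_series (fun n => (INR n + 1) * (INR n + 2) * q ^ n).
Proof.
  intros Hq.
  assert (Hr : Rbar_lt (Rabs q) (CV_radius (fun _ => 1))).
  { apply Rbar_lt_le_trans with 1; [simpl; rewrite Rabs_right; lra|].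
    apply (proj1 (CV_radius_bounded (fun _ => 1))); exists 1; intros n.
    rewrite pow1, Rmult_1_l, Rabs_R1; lra. }
  assert (H : ex_pseries (PS_derive (PS_derive (fun _ => 1))) q).
  { apply ex_pseries_derive; rewrite CV_radius_derive; exact Hr. }
  apply ex_pseries_R in H; revert H; apply ex_series_ext; intros n.
  unfold PS_derive; rewrite !S_INR.
  match goal with |- ?x = ?y => change (@eq R x y) end; ring.
Qed.

Lemma is_Cseries_at_0 (a : nat -> C) : is_Cseries (fun n => a n * 0 ^ n)%C (a O).
Proof.
  apply is_Cseries_iff; intros eps; exists O; intros n _.
  assert (E : sum_n (G := C_NormedModule) (fun n => a n * 0 ^ n)%C n = a O).
  { induction n as [|n IH].
    - rewrite sum_O; simpl; ring.
    - rewrite sum_Sn, IH; change (a O + a (S n) * 0 ^ S n = a O)%C; simpl; ring. }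
  rewrite E; replace (a O - a O)%C with (RtoC 0) by ring; rewrite Cmod_0; apply cond_pos.
Qed.

(** The coefficients are at most [K / rho' ^ n], so the remainders from [pow_second_order] sum to a
    constant times [Cmod h ^ 2], through a series in [q = rho / rho']. *)
Lemma pseries_derive (a : nat -> C) (f : C -> C) (R0 : R) :
  (forall z, Cmod z < R0 -> is_Cseries (fun n => a n * z ^ n)%C (f z)) ->
  forall z, Cmod z < R0 ->
    C_differentiable f z /\
    is_Cseries (fun n => RtoC (INR (S n)) * a (S n) * z ^ n)%C (C_derive f z).
Proof.
  intros Hf z Hz; pose proof (Cmod_ge_0 z) as Hz0.
  (* Two intermediate radii: [rho] contains [z] and [z + h], [rho'] bounds the coefficients, and the
     gap between them makes [q < 1]. *)
  set (rho := (2 * Cmod z + R0) / 3); set (rho' := (Cmod z + 2 * R0) / 3).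
  assert (H1 : 0 < rho /\ Cmod z < rho /\ rho < rho' /\ rho' < R0) by (unfold rho, rho'; lra).
  destruct (is_Cseries_bounded (fun n => a n * RtoC rho' ^ n)%C (f (RtoC rho'))) as [K HK].
  { apply Hf; rewrite Cmod_R, Rabs_right; lra. }
  assert (Ha : forall n, Cmod (a n) <= K / rho' ^ n).
  { intros n; specialize (HK n); rewrite Cmod_mult, Cmod_pow, Cmod_R, Rabs_right in HK by lra.
    apply Rle_div_r; [apply pow_lt; lra | exact HK]. }
  assert (HK0 : 0 <= K) by (eapply Rle_trans; [apply Cmod_ge_0 | apply (HK O)]).
  set (q := rho / rho').
  assert (Hq : 0 <= q < 1).
  { unfold q; split; [apply Rdiv_le_0_compat; lra | apply Rlt_div_l; lra]. }
  destruct (ex_series_quadratic_geom q Hq) as [S0 HS0].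
  assert (HaK : forall n x, 0 <= x -> Cmod (a n) * (x * rho ^ n) <= K * (x * q ^ n)).
  { intros n x Hx.
    apply Rle_trans with (K / rho' ^ n * (x * rho ^ n)).
    - apply Rmult_le_compat_r; [apply Rmult_le_pos; [lra | apply pow_le; lra] | apply Ha].
    - right; unfold q, Rdiv; rewrite Rpow_mult_distr, pow_inv; ring. }
  assert (Hl : exists l, is_Cseries (fun n => RtoC (INR (S n)) * a (S n) * z ^ n)%C l).
  { apply ex_Cseries_le with (fun n => K / rho' * ((INR n + 1) * (INR n + 2) * q ^ n)).
    - intros n; rewrite !Cmod_mult, Cmod_pow, Cmod_R, Rabs_right by (apply Rle_ge, pos_INR).
      pose proof (pos_INR n) as Hn; rewrite S_INR.
      apply Rle_trans with ((INR n + 1) * (K / rho' ^ S n) * rho ^ n).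
      + apply Rmult_le_compat.
        * apply Rmult_le_pos; [lra | apply Cmod_ge_0].
        * apply pow_le; assumption.
        * apply Rmult_le_compat_l; [lra | apply Ha].
        * apply pow_incr; lra.
      + replace ((INR n + 1) * (K / rho' ^ S n) * rho ^ n) with (K / rho' * ((INR n + 1) * q ^ n)).
        * apply Rmult_le_compat_l; [apply Rdiv_le_0_compat; lra|].
          apply Rmult_le_compat_r; [apply pow_le; lra|].
          rewrite <- (Rmult_1_r (INR n + 1)) at 1; apply Rmult_le_compat_l; lra.
        * unfold q, Rdiv; rewrite Rpow_mult_distr, pow_inv; simpl; field.
          split; [apply pow_nonzero|]; lra.
    - apply (ex_series_scal_l (K := R_AbsRing) (V := R_NormedModule) (K / rho')).
      exists S0; exact HS0. }
  destruct Hl as [l Hl].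
  assert (HE : is_Cseries (fun n => a n * pow_derivative z n)%C l).
  { apply is_Cseries_shift.
    replace (l - a O * pow_derivative z O)%C with l by (simpl; ring).
    revert Hl; apply is_Cseries_ext; intros n; unfold pow_derivative; ring. }
  assert (Hder : @is_derive C_AbsRing C_NormedModule f z l).
  { apply is_derive_C_iff; intros eps; pose proof (cond_pos eps) as Heps.
    assert (HS : 0 <= S0).
    { rewrite <- Cmod_0.
      apply (is_Cseries_Cmod_le _ _ _ _) with (2 := is_Cseries_at_0 (fun _ => 0)) (3 := HS0).
      intros n; rewrite Cmult_0_l, Cmod_0; pose proof (pos_INR n).
      repeat apply Rmult_le_pos; try lra; apply pow_le; lra. }
    (* The constant of the quadratic bound, increased by [1] so that division by it is
       legitimate. *)
    set (M := K * S0 / rho ^ 2 + 1).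
    assert (HM : 0 < M).
    { unfold M; assert (0 <= K * S0 / rho ^ 2); [|lra].
      apply Rdiv_le_0_compat; [apply Rmult_le_pos; assumption | apply pow_lt; lra]. }
    assert (Hd : 0 < Rmin (rho - Cmod z) (eps / M)).
    { apply Rmin_pos; [lra | apply Rdiv_lt_0_compat; assumption]. }
    exists (mkposreal _ Hd); cbn [pos]; intros y Hy.
    pose proof (Rmin_l (rho - Cmod z) (eps / M)); pose proof (Rmin_r (rho - Cmod z) (eps / M)).
    set (h := (y - z)%C) in *.
    replace y with (z + h)%C by (unfold h; ring).
    assert (Hzh : Cmod (z + h)%C <= rho) by (eapply Rle_trans; [apply Cmod_triangle | lra]).
    assert (Hbound : Cmod (f (z + h) - f z - h * l)%C <= Cmod h ^ 2 / rho ^ 2 * K * S0).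
    { eapply (is_Cseries_Cmod_le (fun n => a n * (z + h) ^ n - a n * z ^ n - h * (a n * pow_derivative z n))%C
        (fun n => Cmod h ^ 2 / rho ^ 2 * K * ((INR n + 1) * (INR n + 2) * q ^ n))).
      - intros n.
        replace (a n * (z + h) ^ n - a n * z ^ n - h * (a n * pow_derivative z n))%C
          with (a n * ((z + h) ^ n - z ^ n - h * pow_derivative z n))%C by ring.
        rewrite Cmod_mult.
        apply Rmult_le_reg_l with (rho ^ 2); [apply pow_lt; lra|].
        apply Rle_trans with (Cmod (a n) * (Cmod h ^ 2 * (INR n ^ 2 * rho ^ n))).
        + rewrite (Rmult_comm (rho ^ 2)), Rmult_assoc; apply Rmult_le_compat_l; [apply Cmod_ge_0|].
          rewrite Rmult_comm; apply pow_second_order; lra.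
        + apply Rle_trans with (Cmod h ^ 2 * (K * (INR n ^ 2 * q ^ n))).
          * replace (Cmod (a n) * (Cmod h ^ 2 * (INR n ^ 2 * rho ^ n)))
              with (Cmod h ^ 2 * (Cmod (a n) * (INR n ^ 2 * rho ^ n))) by ring.
            apply Rmult_le_compat_l; [apply pow2_ge_0 | apply HaK, pow2_ge_0].
          * replace (rho ^ 2 * (Cmod h ^ 2 / rho ^ 2 * K * ((INR n + 1) * (INR n + 2) * q ^ n)))
              with (Cmod h ^ 2 * (K * ((INR n + 1) * (INR n + 2) * q ^ n))) by (field; lra).
            apply Rmult_le_compat_l; [apply pow2_ge_0|]; apply Rmult_le_compat_l; [assumption|].
            apply Rmult_le_compat_r; [apply pow_le; lra|].
            pose proof (pos_INR n); simpl; lra.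
      - apply is_Cseries_minus; [apply is_Cseries_minus; apply Hf; lra|].
        apply is_Cseries_mult, HE.
      - apply (is_series_scal_l (K := R_AbsRing) (V := R_NormedModule)); exact HS0. }
    eapply Rle_trans; [exact Hbound|].
    pose proof (Cmod_ge_0 h) as Hh.
    replace (Cmod h ^ 2 / rho ^ 2 * K * S0) with ((Cmod h * (K * S0 / rho ^ 2)) * Cmod h) by (field; lra).
    apply Rmult_le_compat_r; [assumption|].
    apply Rle_trans with (eps / M * M); [|right; field; lra].
    apply Rmult_le_compat; try lra; [|unfold M; lra].
    apply Rdiv_le_0_compat; [apply Rmult_le_pos; assumption | apply pow_lt; lra]. }
  split.
  - exists l; exact Hder.
  - rewrite (is_C_derive_unique f z l Hder); exact Hl.
Qed.

Lemma C_derive_n_pseries (a : nat -> C) (f : C -> C) (R0 : R) (m : nat) :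
  (forall z, Cmod z < R0 -> is_Cseries (fun n => a n * z ^ n)%C (f z)) ->
  forall z, Cmod z < R0 ->
    is_Cseries (fun k => RtoC (INR (fact (k + m)) / INR (fact k)) * a (k + m)%nat * z ^ k)%C
      (C_derive_n m f z).
Proof.
  intros Hf; induction m as [|m IH]; intros z Hz.
  - generalize (Hf z Hz); apply is_Cseries_ext; intros n.
    rewrite Nat.add_0_r; unfold Rdiv; rewrite Rinv_r by apply INR_fact_neq_0; ring.
  - generalize (proj2 (pseries_derive _ _ R0 IH z Hz)); apply is_Cseries_ext; intros n.
    replace (S n + m)%nat with (n + S m)%nat by lia.
    rewrite Cmult_assoc, <- RtoC_mult; do 3 f_equal.
    rewrite (fact_simpl n), mult_INR; field.
    split; [apply INR_fact_neq_0 | apply not_0_INR; lia].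
Qed.

(** At [0] only the constant term of the series of the [n]-th derivative remains, namely [n! a_n].
    Any disk of convergence suffices, so expansions on smaller disks determine the same
    coefficients. *)
Lemma coef_pseries (a : nat -> C) (f : C -> C) (R0 : R) (n : nat) :
  0 < R0 -> (forall z, Cmod z < R0 -> is_Cseries (fun n => a n * z ^ n)%C (f z)) ->
  coef f n = a n.
Proof.
  intros HR Hf; unfold coef.
  assert (H0 : Cmod 0 < R0) by (rewrite Cmod_0; exact HR).
  pose proof (C_derive_n_pseries a f R0 n Hf 0 H0) as H.
  rewrite (Cseries_unique _ _ _ H (is_Cseries_at_0 _)); simpl.
  rewrite Rdiv_1_r; field.
  intros E; apply (INR_fact_neq_0 n); apply RtoC_inj in E; exact E.
Qed.

Lemma taylor_coef (f : C -> C) (z : C) :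
  holomorphic_on_disk f -> Cmod z < 1 -> is_Cseries (fun n => coef f n * z ^ n)%C (f z).
Proof.
  intros Hf Hz; pose proof (Cmod_ge_0 z).
  set (r := (Cmod z + 1) / 2).
  assert (Hr : 0 < r < 1 /\ Cmod z < r) by (unfold r; lra).
  generalize (taylor f r z Hf (proj1 Hr) (proj2 Hr)); apply is_Cseries_ext; intros n; f_equal.
  symmetry; apply (coef_pseries _ f r); [lra|].
  intros w Hw; apply taylor; tauto.
Qed.

Lemma cauchy_coef_eq (f : C -> C) (r : R) (n : nat) :
  holomorphic_on_disk f -> 0 < r < 1 -> cauchy_coef f r n = coef f n.
Proof.
  intros Hf Hr; symmetry; apply (coef_pseries _ f r); [lra|].
  intros w Hw; apply taylor; trivial.
Qed.

(** * Functions with positive real part *)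

(** Write [Re P] as half of [P + Cconj P]. The first part gives a Cauchy coefficient; the second is
    the conjugate of an integral of [P z^n], which vanishes for [n >= 1] and doubles the
    contribution for [n = 0]. *)
Lemma is_CInt_real_part_moment (P : C -> C) (r : R) (n : nat) :
  holomorphic_on_disk P -> coef P 0 = 1 -> 0 < r < 1 ->
  is_CInt (fun t => RtoC (Re (P (circ r t))) * (RtoC r / circ r t) ^ n)%C 0 (2 * PI)
    match n with
    | O => RtoC (2 * PI)
    | S _ => (RtoC (2 * PI) * (coef P n * RtoC r ^ n / 2))%C
    end.
Proof.
  intros HP H0 Hr; pose proof PI_RGT_0 as Hpi.
  assert (Hrc : RtoC r <> 0) by (intros E; apply RtoC_inj in E; lra).
  assert (H2 : RtoC 2 <> 0) by (intros E; apply RtoC_inj in E; lra).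
  pose proof (is_CInt_cauchy_coef P r n (holomorphic_continuous_on_disk P HP) Hr) as H1.
  rewrite cauchy_coef_eq in H1 by assumption.
  assert (Hconj : is_CInt (fun t => Cconj (P (circ r t)) * (RtoC r / circ r t) ^ n)%C 0 (2 * PI)
    match n with O => RtoC (2 * PI) | S _ => 0 end).
  { destruct n as [|n].
    - replace (RtoC (2 * PI)) with (Cconj (RtoC (2 * PI) * coef P 0)%C)
        by (rewrite H0, Cmult_1_r; unfold Cconj; simpl; rewrite Ropp_0; reflexivity).
      apply is_CInt_ext with (2 := fun t _ => eq_sym (Cmult_1_r _)); [lra|].
      apply is_CInt_conj; apply is_CInt_ext with (3 := H1); [lra|].
      intros t _; simpl; field; apply C1_nz.
    - replace (RtoC 0) with (RtoC (/ r) ^ S n * Cconj 0)%C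
        by (unfold Cconj; simpl fst; simpl snd; rewrite Ropp_0; fold (RtoC 0); ring).
      apply is_CInt_ext with (fun t => RtoC (/ r) ^ S n * Cconj (P (circ r t) * circ r t ^ S n))%C; [lra | |].
      + intros t _; unfold Cdiv; rewrite Cinv_circ, Cmult_conj, Cpow_conj by lra.
        replace (RtoC r * (RtoC (/ r ^ 2) * Cconj (circ r t)))%C with (RtoC (/ r) * Cconj (circ r t))%C.
        * rewrite Cpow_mult_l; ring.
        * rewrite Cmult_assoc, <- RtoC_mult; do 2 f_equal; field; lra.
      + apply is_CInt_mult, is_CInt_conj, is_CInt_circle_mult_pow; assumption. }
  apply (is_CInt_mult (RtoC r ^ n)) in H1.
  pose proof (is_CInt_mult (/ 2) _ _ _ _ (is_CInt_plus _ _ _ _ _ _ H1 Hconj)) as H3.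
  match goal with |- is_CInt _ _ _ ?l => match type of H3 with is_CInt _ _ _ ?l' => replace l with l' end end.
  - apply is_CInt_ext with (3 := H3); [lra|].
    intros t _; rewrite re_alt; pose proof (circ_neq_0 r t (proj1 Hr)) as Hz.
    unfold Cdiv; rewrite Cpow_mult_l, Cpow_inv by assumption; ring.
  - destruct n as [|n]; [rewrite H0; simpl; field | field]; assumption.
Qed.

(** The square is written as the real part of an expression affine in [u], so that its mean needs
    only the moments of order [0] and [1]. *)
Lemma Cmod2_sub (u m : C) : Cmod u = 1 ->
  Cmod (u - m)%C ^ 2 = Re (1 + RtoC (Cmod m ^ 2) - 2 * Cconj m * u)%C.
Proof.
  intros Hu.
  assert (H1 : Re u ^ 2 + Im u ^ 2 = 1) by (rewrite <- Cmod2_alt, Hu; ring).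
  rewrite !Cmod2_alt; destruct u as [a b], m as [c d]; simpl in *; nra.
Qed.

Lemma caratheodory_moments (P : C -> C) (r : R) :
  holomorphic_on_disk P -> coef P 0 = 1 -> (forall z, Cmod z < 1 -> 0 <= Re (P z)) ->
  0 < r < 1 ->
  Cmod (coef P 2 * RtoC r ^ 2 / 2 - (coef P 1 * RtoC r / 2) ^ 2)%C
  <= 1 - Cmod (coef P 1 * RtoC r / 2)%C ^ 2.
Proof.
  intros HP H0 Hpos Hr; pose proof PI_RGT_0 as Hpi.
  set (m := (coef P 1 * RtoC r / 2)%C).
  set (u := fun t => (RtoC r / circ r t)%C).
  pose proof (is_CInt_real_part_moment P r 0 HP H0 Hr) as M0.
  pose proof (is_CInt_real_part_moment P r 1 HP H0 Hr) as M1.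
  pose proof (is_CInt_real_part_moment P r 2 HP H0 Hr) as M2.
  cbv iota in M0, M1, M2; rewrite Cpow_1_r in M1; fold m in M1.
  assert (A : is_CInt (fun t => RtoC (Re (P (circ r t))) * (u t - m) ^ 2)%C 0 (2 * PI)
    (RtoC (2 * PI) * (coef P 2 * RtoC r ^ 2 / 2 - m ^ 2))%C).
  { pose proof (is_CInt_plus _ _ _ _ _ _ (is_CInt_minus _ _ _ _ _ _ M2 (is_CInt_mult (2 * m) _ _ _ _ M1))
      (is_CInt_mult (m ^ 2) _ _ _ _ M0)) as H.
    match type of H with is_CInt _ _ _ ?l =>
      replace (RtoC (2 * PI) * (coef P 2 * RtoC r ^ 2 / 2 - m ^ 2))%C with l by ring end.
    apply is_CInt_ext with (3 := H); [lra|]; intros t _; unfold u; simpl; ring. }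
  assert (B : is_CInt (fun t => RtoC (Re (P (circ r t))) * (1 + RtoC (Cmod m ^ 2) - 2 * Cconj m * u t))%C
    0 (2 * PI) (RtoC (2 * PI) * RtoC (1 - Cmod m ^ 2))%C).
  { pose proof (is_CInt_minus _ _ _ _ _ _ (is_CInt_mult (1 + RtoC (Cmod m ^ 2)) _ _ _ _ M0)
      (is_CInt_mult (2 * Cconj m) _ _ _ _ M1)) as H.
    match type of H with is_CInt _ _ _ ?l =>
      replace (RtoC (2 * PI) * RtoC (1 - Cmod m ^ 2))%C with l end.
    - apply is_CInt_ext with (3 := H); [lra|]; intros t _; unfold u; simpl; ring.
    - rewrite RtoC_minus, Cmod2_conj; ring. }
  (* The real part of [B] is the mean of [Cmod (u t - m) ^ 2], the majorant of the integrand of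
     [A]. *)
  apply is_CInt_Re in B; rewrite <- RtoC_mult in B; simpl Re in B at 2.
  assert (Hu : forall t, Cmod (u t) = 1).
  { intros t; unfold u; rewrite Cmod_div by (apply circ_neq_0; lra).
    rewrite Cmod_circ, Cmod_R, Rabs_right by lra; field; lra. }
  assert (H : Cmod (RtoC (2 * PI) * (coef P 2 * RtoC r ^ 2 / 2 - m ^ 2))%C <= 2 * PI * (1 - Cmod m ^ 2)).
  { refine (is_CInt_norm_le _ _ _ _ _ _ _ _ A B); [lra|].
    intros t _; cbv beta.
    rewrite Cmod_mult, Cmod_R, Rabs_right, Cmod_pow, re_scal_l, Cmod2_sub; [lra | apply Hu |].
    apply Rle_ge, Hpos; rewrite Cmod_circ; lra. }
  rewrite Cmod_mult, Cmod_R, Rabs_right in H by lra.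
  apply Rmult_le_reg_l with (2 * PI); [lra | exact H].
Qed.

(** This replaces the limit [r -> 1]. If [B < A], the value at [s = 1 / 2] forces [B >= 0], and
    [s = (A + B) / (2 A)] makes [s * A] the midpoint of [A] and [B], which exceeds [B]. *)
Lemma le_of_scaled_le (A B : R) : 0 <= A -> (forall s, 0 < s < 1 -> s * A <= B) -> A <= B.
Proof.
  intros HA H; apply Rnot_lt_le; intros Hlt.
  pose proof (H (1 / 2) ltac:(lra)) as H1.
  assert (Hs : 0 < (A + B) / (2 * A) < 1).
  { split; [apply Rdiv_lt_0_compat; lra | apply Rlt_div_l; lra]. }
  pose proof (H _ Hs) as H2.
  replace ((A + B) / (2 * A) * A) with ((A + B) / 2) in H2 by (field; lra); lra.
Qed.

(** The left side of the moment inequality is nonnegative, hence [Cmod m <= 1]. *)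
Lemma caratheodory_coef_1 (P : C -> C) :
  holomorphic_on_disk P -> coef P 0 = 1 -> (forall z, Cmod z < 1 -> 0 <= Re (P z)) ->
  Cmod (coef P 1) <= 2.
Proof.
  intros HP H0 Hpos; apply le_of_scaled_le; [apply Cmod_ge_0|]; intros r Hr.
  pose proof (caratheodory_moments P r HP H0 Hpos Hr) as H.
  set (m := (coef P 1 * RtoC r / 2)%C) in *.
  assert (E : Cmod m = r * Cmod (coef P 1) / 2).
  { unfold m; rewrite Cmod_div by (intros E; apply RtoC_inj in E; lra).
    rewrite Cmod_mult, !Cmod_R, !Rabs_right by lra; field. }
  pose proof (Cmod_ge_0 (coef P 2 * RtoC r ^ 2 / 2 - m ^ 2)%C).
  pose proof (Cmod_ge_0 m).
  assert (Cmod m <= 1) by nra.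
  lra.
Qed.

Lemma caratheodory_fekete_szego (P : C -> C) (v : R) :
  holomorphic_on_disk P -> coef P 0 = 1 -> (forall z, Cmod z < 1 -> 0 <= Re (P z)) ->
  1 <= v -> Cmod (coef P 2 - RtoC v * coef P 1 ^ 2)%C <= 4 * v - 2.
Proof.
  intros HP H0 Hpos Hv; apply le_of_scaled_le; [apply Cmod_ge_0|]; intros s Hs.
  (* The functional has degree two in [r]: with [s = r ^ 2] it equals [2 * A - (4 v - 2) * m ^ 2]
     after scaling by [s]. *)
  set (r := sqrt s).
  assert (Hr2 : r ^ 2 = s) by (unfold r; simpl; rewrite Rmult_1_r; apply sqrt_sqrt; lra).
  assert (Hr : 0 < r < 1).
  { assert (0 < r) by (apply sqrt_lt_R0; lra); split; [assumption | nra]. }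
  pose proof (caratheodory_moments P r HP H0 Hpos Hr) as H.
  set (m := (coef P 1 * RtoC r / 2)%C) in *.
  assert (H2 : RtoC 2 <> 0) by (intros E; apply RtoC_inj in E; lra).
  set (A := (coef P 2 * RtoC r ^ 2 / 2 - m ^ 2)%C) in *.
  assert (E : (RtoC s * (coef P 2 - RtoC v * coef P 1 ^ 2))%C = (2 * A - RtoC (4 * v - 2) * m ^ 2)%C).
  { rewrite <- Hr2, RtoC_pow, RtoC_minus, RtoC_mult; unfold A, m.
    replace (RtoC 4) with (RtoC 2 * RtoC 2)%C by (rewrite <- RtoC_mult; f_equal; ring).
    field; assumption. }
  replace (s * Cmod (coef P 2 - RtoC v * coef P 1 ^ 2)%C)
    with (Cmod (2 * A - RtoC (4 * v - 2) * m ^ 2)%C)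
    by (rewrite <- E, Cmod_mult, Cmod_R, Rabs_right by lra; reflexivity).
  assert (T : Cmod (2 * A - RtoC (4 * v - 2) * m ^ 2)%C <= 2 * Cmod A + (4 * v - 2) * Cmod m ^ 2).
  { eapply Rle_trans; [apply Cmod_triangle|].
    rewrite Cmod_opp, !Cmod_mult, Cmod_pow, !Cmod_R, !Rabs_right by lra; lra. }
  pose proof (Cmod_ge_0 A); nra.
Qed.

(** * The class [class_A_beta], its extremal function and the bounds *)

(* The factor by which [f |-> beta f(z)/z + (1 - beta) f'] multiplies the coefficient of [z^n]. *)
Definition beta_weight (beta : R) (n : nat) : R := beta + (1 - beta) * INR n.

(** Dividing [f] by [z] shifts the coefficients by one, and differentiating also shifts them, with
    the factor [n + 1]; the two series therefore add term by term. *)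
Lemma is_Cseries_beta_mean (beta : R) (a : nat -> C) (f : C -> C) (z : C) :
  (forall z, Cmod z < 1 -> is_Cseries (fun n => a n * z ^ n)%C (f z)) -> a O = 0 ->
  Cmod z < 1 -> z <> 0 ->
  is_Cseries (fun n => RtoC (beta_weight beta (S n)) * a (S n) * z ^ n)%C
    (RtoC beta * (f z / z) + RtoC (1 - beta) * C_derive f z)%C.
Proof.
  intros Hf Ha Hz Hz0.
  pose proof (proj2 (pseries_derive a f 1 Hf z Hz)) as H1.
  pose proof (proj1 (is_Cseries_shift _ _) (Hf z Hz)) as H2.
  apply (is_Cseries_mult (/ z)) in H2.
  generalize (is_Cseries_plus _ _ _ _ (is_Cseries_mult (RtoC beta) _ _ H2) (is_Cseries_mult (RtoC (1 - beta)) _ _ H1)).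
  replace (/ z * (f z - a O * z ^ 0))%C with (f z / z)%C by (rewrite Ha; field; assumption).
  apply is_Cseries_ext; intros n; unfold beta_weight; rewrite RtoC_plus, RtoC_mult.
  rewrite Cpow_S; field; assumption.
Qed.

Lemma class_A_beta_caratheodory (beta : R) (f : C -> C) : class_A_beta beta f ->
  exists P, holomorphic_on_disk P /\ (forall z, Cmod z < 1 -> 0 <= Re (P z)) /\
    coef P 0 = 1 /\
    coef P 1 = (RtoC (2 - beta) * coef f 2)%C /\ coef P 2 = (RtoC (3 - 2 * beta) * coef f 3)%C.
Proof.
  intros [[Hf [Hf0 Hf1]] Hre].
  assert (H0 : coef f 0 = 0) by (unfold coef; simpl; rewrite Hf0; field; apply C1_nz).
  assert (H1 : coef f 1 = 1) by (unfold coef; simpl; rewrite Hf1; field; apply C1_nz).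
  (* At [0] the expression [f z / z] evaluates to [0] rather than to its limit, so the limit value
     [1] is prescribed; it agrees with the sum of the series there. *)
  set (P := fun z => if Ceq_dec z 0 then RtoC 1
    else (RtoC beta * (f z / z) + RtoC (1 - beta) * C_derive f z)%C).
  assert (HP : forall z, Cmod z < 1 ->
    is_Cseries (fun n => RtoC (beta_weight beta (S n)) * coef f (S n) * z ^ n)%C (P z)).
  { intros z Hz; unfold P; destruct (Ceq_dec z 0) as [-> | Hz0].
    - pose proof (is_Cseries_at_0 (fun n => RtoC (beta_weight beta (S n)) * coef f (S n))%C) as H.
      cbv beta in H; rewrite H1 in H; unfold beta_weight at 2 in H.
      replace (RtoC (beta + (1 - beta) * INR 1) * 1)%C with (RtoC 1) in H; [exact H|].
      rewrite Cmult_1_r; f_equal; simpl; ring.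
    - apply is_Cseries_beta_mean; trivial.
      intros w Hw; apply taylor_coef; assumption. }
  assert (Hc : forall n, coef P n = (RtoC (beta_weight beta (S n)) * coef f (S n))%C).
  { intros n; apply (coef_pseries (fun n => RtoC (beta_weight beta (S n)) * coef f (S n))%C P 1); [lra | exact HP]. }
  exists P; repeat split.
  - intros z Hz; exact (proj1 (pseries_derive _ P 1 HP z Hz)).
  - intros z Hz; unfold P; destruct (Ceq_dec z 0) as [_ | Hz0]; [simpl; lra|].
    apply Rlt_le, Hre; assumption.
  - rewrite Hc, H1, Cmult_1_r; f_equal; unfold beta_weight; simpl; ring.
  - rewrite Hc; do 2 f_equal; unfold beta_weight; simpl; ring.
  - rewrite Hc; do 2 f_equal; unfold beta_weight; simpl; ring.
Qed.

(** The coefficients [1, 2, 2, ...] of [(1 + z) / (1 - z)], shifted by one and divided by the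
    weights; the weight of [z] itself is [1]. *)
Definition extremal_coef (beta : R) (n : nat) : C :=
  match n with
  | O => 0
  | S O => 1
  | _ => RtoC (2 / beta_weight beta n)
  end.

Lemma beta_weight_ge_1 (beta : R) (n : nat) : 0 <= beta <= 1 -> 1 <= beta_weight beta (S n).
Proof.
  intros Hb; unfold beta_weight; rewrite S_INR; pose proof (pos_INR n); nra.
Qed.

Lemma extremal_function (beta : R) : 0 <= beta <= 1 ->
  exists f, class_A_beta beta f /\ forall n, coef f n = extremal_coef beta n.
Proof.
  intros Hb.
  assert (Hle : forall n, Cmod (extremal_coef beta n) <= 2).
  { intros [|[|n]]; unfold extremal_coef.
    - rewrite Cmod_0; lra.
    - rewrite Cmod_1; lra.
    - pose proof (beta_weight_ge_1 beta (S n) Hb).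
      rewrite Cmod_R, Rabs_right by (apply Rle_ge, Rdiv_le_0_compat; lra).
      apply Rle_div_l; lra. }
  assert (Hgeom : forall z (b : nat -> C), (forall n, Cmod (b n) <= 2) -> Cmod z < 1 ->
    exists l, is_Cseries (fun n => b n * z ^ n)%C l).
  { intros z b Hb2 Hz; apply ex_Cseries_le with (fun n => 2 * Cmod z ^ n).
    - intros n; rewrite Cmod_mult, Cmod_pow.
      apply Rmult_le_compat_r; [apply pow_le, Cmod_ge_0 | apply Hb2].
    - apply (ex_series_scal_l (K := R_AbsRing) (V := R_NormedModule) 2), ex_series_geom.
      rewrite Rabs_right; [exact Hz | apply Rle_ge, Cmod_ge_0]. }
  (* Choice makes the sum a total function; outside the disk its value is arbitrary. *)
  set (f := fun z => epsilon (inhabits (RtoC 0)) (fun l => is_Cseries (fun n => extremal_coef beta n * z ^ n)%C l)).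
  assert (Hf : forall z, Cmod z < 1 -> is_Cseries (fun n => extremal_coef beta n * z ^ n)%C (f z)).
  { intros z Hz; apply epsilon_spec; apply Hgeom; assumption. }
  assert (Hc : forall n, coef f n = extremal_coef beta n).
  { intros n; apply (coef_pseries _ f 1); [lra | exact Hf]. }
  exists f; split; [|exact Hc].
  assert (Hinv1 : forall c : C, (c / 1)%C = c) by (intros c; field; apply C1_nz).
  split; [split; [|split]|].
  - intros z Hz; exact (proj1 (pseries_derive _ f 1 Hf z Hz)).
  - specialize (Hc O); unfold coef in Hc; simpl in Hc; rewrite Hinv1 in Hc; exact Hc.
  - specialize (Hc 1%nat); unfold coef in Hc; simpl in Hc; rewrite Hinv1 in Hc; exact Hc.
  - intros z Hz Hz0.
    pose proof (is_Cseries_beta_mean beta _ f z Hf eq_refl Hz Hz0) as HV.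
    set (V := (RtoC beta * (f z / z) + RtoC (1 - beta) * C_derive f z)%C) in *.
    destruct (Hgeom z (fun _ => RtoC 1)) as [s Hs]; [intros _; rewrite Cmod_1; lra | assumption |].
    pose proof (proj1 (is_Cseries_shift _ _) Hs) as Hs'.
    (* Comparing the geometric series with its shift says [s = 1 / (1 - z)] without a division; [E2]
       and [E3] then identify [V] with [(1 + z) / (1 - z)]. *)
    assert (E1 : (s - 1)%C = (z * s)%C).
    { apply (Cseries_unique (fun n => 1 * z ^ S n)%C).
      - replace (s - 1)%C with (s - 1 * z ^ 0)%C by (simpl; ring); exact Hs'.
      - generalize (is_Cseries_mult z _ _ Hs); apply is_Cseries_ext; intros n; simpl; ring. }
    assert (E2 : (V - 1)%C = (2 * z * s)%C).
    { apply is_Cseries_shift in HV; cbv beta in HV.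
      replace (V - 1)%C with (V - RtoC (beta_weight beta 1) * extremal_coef beta 1 * z ^ 0)%C.
      - apply (Cseries_unique _ _ _ HV).
        generalize (is_Cseries_mult (2 * z) _ _ Hs); apply is_Cseries_ext; intros n.
        pose proof (beta_weight_ge_1 beta (S n) Hb).
        unfold extremal_coef; rewrite <- RtoC_mult.
        replace (beta_weight beta (S (S n)) * (2 / beta_weight beta (S (S n)))) with 2 by (field; lra).
        simpl; ring.
      - replace (beta_weight beta 1) with 1 by (unfold beta_weight; simpl; ring).
        simpl; ring. }
    assert (E3 : (V * (1 - z))%C = (1 + z)%C).
    { replace (V * (1 - z))%C with ((V - 1) * (1 - z) + 1 - z)%C by ring.
      rewrite E2.
      replace (2 * z * s * (1 - z))%C with (2 * z * (s - z * s))%C by ring.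
      rewrite <- E1; ring. }
    pose proof (Cmod2_alt z) as Hz2; pose proof (Cmod_ge_0 z) as Hz1.
    assert (Hlt : Cmod z ^ 2 < 1) by nra; rewrite Hz2 in Hlt.
    clearbody V; destruct V as [p q], z as [x y]; simpl in Hlt |- *.
    injection E3 as Ep Eq; simpl in Ep, Eq.
    (* Multiplying [E3] by the conjugate of [1 - z] and taking real parts gives
       [Re V * |1 - z|^2 = 1 - |z|^2], which is positive. *)
    assert (E : p * ((1 - x) ^ 2 + y ^ 2) = 1 - x ^ 2 - y ^ 2).
    { replace (p * ((1 - x) ^ 2 + y ^ 2)) with
        ((p * (1 + - x) - q * (0 + - y)) * (1 - x) - (p * (0 + - y) + q * (1 + - x)) * y) by ring.
      rewrite Ep, Eq; ring. }
    assert (0 <= (1 - x) ^ 2 + y ^ 2) by (apply Rplus_le_le_0_compat; apply pow2_ge_0).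
    apply Rnot_le_lt; intros Hp; nra.
Qed.

Theorem theorem2p3 (beta : R) (Hb : 0 <= beta <= 1) :
  (forall f : C -> C, class_A_beta beta f ->
     Cmod (Gamma1 f) <= 1 / (2 - beta) /\
     Cmod (Gamma2 f) <= (5 - 2 * beta - beta ^ 2) / ((2 - beta) ^ 2 * (3 - 2 * beta)))
  /\ (exists f : C -> C, class_A_beta beta f /\ Cmod (Gamma1 f) = 1 / (2 - beta))
  /\ (exists f : C -> C, class_A_beta beta f /\
        Cmod (Gamma2 f) = (5 - 2 * beta - beta ^ 2) / ((2 - beta) ^ 2 * (3 - 2 * beta))).
Proof.
  split; [|split].
  - intros f Hf.
    destruct (class_A_beta_caratheodory beta f Hf) as [P [HP [Hpos [P0 [P1 P2]]]]].
    split.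
    + pose proof (caratheodory_coef_1 P HP P0 Hpos) as H.
      rewrite P1, Cmod_mult, Cmod_R, Rabs_right in H by lra.
      unfold Gamma1; rewrite Cmod_mult, Cmod_R, Rabs_left by lra.
      apply (Rle_div_r _ 1 (2 - beta)); [lra|].
      replace (- - / 2 * Cmod (coef f 2) * (2 - beta)) with ((2 - beta) * Cmod (coef f 2) / 2) by field.
      lra.
    (* Substituting [a2 = c1 / (2 - beta)] and [a3 = c2 / (3 - 2 beta)] in [Gamma2] and factoring
       out [- 1 / (2 (3 - 2 beta))] leaves [c2 - v c1^2] with this [v]. *)
    + set (v := 3 * (3 - 2 * beta) / (2 * (2 - beta) ^ 2)).
      assert (Hv : 1 <= v).
      { unfold v; apply Rle_div_r; [apply Rmult_lt_0_compat; [lra | apply pow_lt; lra] |].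
        (* The claim [1 <= v] follows from [3 (3 - 2 beta) - 2 (2 - beta)^2 = 1 + 2 beta (1 -
           beta)]. *)
        assert (0 <= beta * (1 - beta)) by (apply Rmult_le_pos; lra); nra. }
      pose proof (caratheodory_fekete_szego P v HP P0 Hpos Hv) as H.
      assert (E : Gamma2 f = (RtoC (- / (2 * (3 - 2 * beta))) * (coef P 2 - RtoC v * coef P 1 ^ 2))%C).
      { rewrite P1, P2; unfold Gamma2.
        set (a2 := coef f 2); set (a3 := coef f 3).
        transitivity (RtoC (- / (2 * (3 - 2 * beta)) * (3 - 2 * beta)) * a3
          - RtoC (- / (2 * (3 - 2 * beta)) * v * (2 - beta) ^ 2) * a2 ^ 2)%C.
        - replace (- / (2 * (3 - 2 * beta)) * (3 - 2 * beta)) with (- / 2) by (field; lra).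
          replace (- / (2 * (3 - 2 * beta)) * v * (2 - beta) ^ 2) with (- / 2 * (3 / 2))
            by (unfold v; field; lra).
          rewrite (RtoC_mult (- / 2)); simpl; ring.
        - rewrite !RtoC_mult, RtoC_pow; ring. }
      rewrite E, Cmod_mult, Cmod_R, Rabs_left
        by (apply Ropp_lt_gt_0_contravar, Rinv_0_lt_compat; lra).
      rewrite Ropp_involutive.
      apply Rle_trans with (/ (2 * (3 - 2 * beta)) * (4 * v - 2)).
      * apply Rmult_le_compat_l; [apply Rlt_le, Rinv_0_lt_compat; lra | exact H].
      * right; unfold v; field; lra.
  - destruct (extremal_function beta Hb) as [f [Hf Hc]]; exists f; split; [exact Hf|].
    unfold Gamma1; rewrite Hc; unfold extremal_coef, beta_weight; simpl INR.
    rewrite <- RtoC_mult, Cmod_R, Rabs_left1.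
    + field; lra.
    + assert (0 < 2 / (beta + (1 - beta) * (1 + 1))) by (apply Rdiv_lt_0_compat; lra); lra.
  - destruct (extremal_function beta Hb) as [f [Hf Hc]]; exists f; split; [exact Hf|].
    unfold Gamma2; rewrite !Hc; unfold extremal_coef, beta_weight; simpl INR.
    rewrite <- !RtoC_mult, <- RtoC_minus, <- RtoC_mult, Cmod_R.
    (* Here [Gamma2] is real, equal to [3 / (2 - beta)^2 - 1 / (3 - 2 beta)]; its numerator
       [5 - 2 beta - beta^2] is at least [2], so the modulus changes nothing. *)
    replace (- / 2 * (2 / (beta + (1 - beta) * (1 + 1 + 1)) - 3 / 2 *
      (2 / (beta + (1 - beta) * (1 + 1)) * (2 / (beta + (1 - beta) * (1 + 1))))))
      with ((5 - 2 * beta - beta ^ 2) / ((2 - beta) ^ 2 * (3 - 2 * beta))) by (field; lra).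
    apply Rabs_right, Rle_ge, Rdiv_le_0_compat; [nra|].
    apply Rmult_lt_0_compat; [apply pow_lt; lra | lra].
Qed.
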